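(* Let $H$ be a separable complex Hilbert space (finite- or infinite-dimensional) with $\dim H \ge 3$, and let $\mathcal{P}(H)$ be the set of all rank one projections on $H$. Let $\phi : \mathcal{P}(H) \to \mathcal{P}(H)$ be a map (not assumed injective or surjective) preserving orthogonality in one direction, that is, for every pair $P, Q \in \mathcal{P}(H)$, $PQ = 0$ implies $\phi(P)\phi(Q) = 0$. Assume that there exists a complete orthogonal system of projections of rank one $\{P_1, P_2, \ldots\} \subset \mathcal{P}(H)$ such that $\{\phi(P_1), \phi(P_2), \ldots\}$ is a complete orthogonal system of projections of rank one. Then $\phi$ is a Wigner symmetry, i.e. there exists a unitary or antiunitary operator $U : H \to H$ such that $\phi(P) = U P U^\ast$ for every $P \in \mathcal{P}(H)$.
   Context: Projections are orthogonal (self-adjoint, idempotent) bounded linear operators on $H$; $\mathcal{P}(H)$ denotes the set of those of rank one. For $P, Q \in \mathcal{P}(H)$, write $P \perp Q$ if $PQ = 0$ (equivalently $\mathrm{tr}(PQ) = 0$). A (finite or countably infinite) subset $\{P_1, P_2, \ldots\} \subset \mathcal{P}(H)$ is called a complete orthogonal system of projections of rank one (COSP) if $P_i \perp P_j$ whenever $i \ne j$ and there is no $Q \in \mathcal{P}(H)$ that is orthogonal to every $P_j$. Equivalently, if $P_j$ is the projection onto the span of a unit vector $x_j$, then $\{P_1, P_2, \ldots\}$ is a COSP if and only if $\{x_1, x_2, \ldots\}$ is an orthonormal basis of $H$. An antiunitary operator is a bijective conjugate-linear isometry $U : H \to H$; its adjoint is the conjugate-linear map $U^\ast = U^{-1}$,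 so in both the unitary and the antiunitary case $U P U^\ast$ is the rank one projection onto $U(\mathrm{Im}\, P)$. A Wigner symmetry is a map $\phi : \mathcal{P}(H) \to \mathcal{P}(H)$ of the form $\phi(P) = U P U^\ast$, $P \in \mathcal{P}(H)$, for some unitary or antiunitary operator $U : H \to H$. *)

(* Defs.v *)
From HB Require Import structures.
From mathcomp Require Import all_boot all_order all_algebra.
From mathcomp Require Import all_classical all_reals.
From mathcomp Require Import topology normedtype.
From mathcomp Require Import complex.
Set Implicit Arguments.
Unset Strict Implicit.
Unset Printing Implicit Defensive.
Import Order.TTheory GRing.Theory Num.Theory.
Import numFieldNormedType.Exports.

Local Open Scope classical_set_scope.
Local Open Scope complex_scope.
Local Open Scope ring_scope.

Definition separable_space (T : topologicalType) : Prop :=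
  exists2 D : set T, countable D & dense D.

Definition lin_indep (K : pzRingType) (V : lmodType K) (n : nat)
    (e : 'I_n -> V) : Prop :=
  forall c : 'I_n -> K, \sum_(i < n) c i *: e i = 0 -> forall i, c i = 0.

Definition dim_ge (K : pzRingType) (V : lmodType K) (n : nat) : Prop :=
  exists e : 'I_n -> V, lin_indep e.

(* A Hilbert space is a complete normed module over the complex numbers R[i]
   together with an inner product [dot] (linear in the first argument,
   conjugate-linear in the second) that induces the norm. *)
Definition induces_norm (R : realType) (H : normedModType R[i])
    (dot : {dot H for Num.conj}) : Prop :=
  forall x : H, `|x| ^+ 2 = dot x x.

Definition bounded_linear (R : realType) (H : normedModType R[i])
    (A : H -> H) : Prop :=
  linear A /\ exists M : R, forall x, `|A x| <= M%:C * `|x|.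

Definition adjoint_of (R : realType) (H : normedModType R[i])
    (dot : {dot H for Num.conj}) (A B : H -> H) : Prop :=
  forall x y, dot (A x) y = dot x (B y).

Definition is_projection (R : realType) (H : normedModType R[i])
    (dot : {dot H for Num.conj}) (P : H -> H) : Prop :=
  [/\ bounded_linear P, adjoint_of dot P P & P \o P = P].

Definition rank_one (K : pzRingType) (V : lmodType K) (A : V -> V) : Prop :=
  exists2 u : V, u != 0 & range A = [set a *: u | a in [set: K]].

Record rank1proj (R : realType) (H : normedModType R[i])
    (dot : {dot H for Num.conj}) : Type := Rank1Proj {
  r1p_op :> H -> H ;
  r1p_projection : is_projection dot r1p_op ;
  r1p_rank_one : rank_one r1p_op }.

Lemma rank1proj_ext (R : realType) (H : normedModType R[i])
    (dot : {dot H for Num.conj}) (P Q : rank1proj dot) :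
  P = Q :> (H -> H) -> P = Q.
Proof.
case: P Q => [P p1 p2] [Q q1 q2] /= PQ; subst Q.
by rewrite (Prop_irrelevance p1 q1) (Prop_irrelevance p2 q2).
Qed.

Definition proj_orth (R : realType) (H : normedModType R[i])
    (dot : {dot H for Num.conj}) (P Q : rank1proj dot) : Prop :=
  forall x, P (Q x) = 0.

Definition COSP (R : realType) (H : normedModType R[i])
    (dot : {dot H for Num.conj}) (S : set (rank1proj dot)) : Prop :=
  [/\ countable S,
      forall P Q, S P -> S Q -> P <> Q -> proj_orth P Q &
      ~ exists Q, forall P, S P -> proj_orth Q P].

Definition preserves_orth (R : realType) (H : normedModType R[i])
    (dot : {dot H for Num.conj}) (phi : rank1proj dot -> rank1proj dot) : Prop :=
  forall P Q, proj_orth P Q -> proj_orth (phi P) (phi Q).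

(* In the next two predicates V is the adjoint of U.  For an antiunitary U the
   adjoint is by convention the inverse map. *)
Definition is_unitary (R : realType) (H : normedModType R[i])
    (dot : {dot H for Num.conj}) (U V : H -> H) : Prop :=
  [/\ bounded_linear U, adjoint_of dot U V, cancel U V & cancel V U].

Definition is_antiunitary (R : realType) (H : normedModType R[i])
    (U V : H -> H) : Prop :=
  [/\ linear_for (Num.conj \; *:%R) U,
      forall x y, `|U x - U y| = `|x - y|, cancel U V & cancel V U].

Definition wigner_symmetry (R : realType) (H : normedModType R[i])
    (dot : {dot H for Num.conj}) (phi : rank1proj dot -> rank1proj dot) : Prop :=
  exists U V : H -> H,
    (is_unitary dot U V \/ is_antiunitary U V) /\
    forall P : rank1proj dot, phi P = U \o P \o V :> (H -> H).

(* Main.v *)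
Require Import Defs.
From HB Require Import structures.
From mathcomp Require Import all_boot all_order all_algebra.
From mathcomp Require Import all_classical all_reals.
From mathcomp Require Import topology normedtype.
From mathcomp Require Import complex ring.
Import Order.TTheory GRing.Theory Num.Theory.
Import numFieldNormedType.Exports.
Set Implicit Arguments.
Unset Strict Implicit.
Unset Printing Implicit Defensive.

Local Open Scope classical_set_scope.
Local Open Scope ring_scope.

(** The map is studied through coordinates.  Send the given system to an orthonormal
    basis [e] and its image to an orthonormal basis [f].  Completeness of [f] forces
    the image of a vector supported on three basis vectors to be supported on the
    three corresponding ones, so each triple yields an orthogonality preserving map
    of the projective plane.  Applied to the thirteen rays with coordinates in
    [{-1, 0, 1}], orthogonality gives four vanishing 3x3 determinants, which force the
    image of [e i + e j] to have two coordinates of equal nonzero modulus; after a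
    change of phases in [f] it is [f i + f j].  Then the rays [(1, x, 0)] go to rays
    [(1, sigma x, 0)], where [sigma] is a priori a place of the complex field
    commuting with conjugation; as positive reals are squares and the reals are
    archimedean, [sigma] is finite, hence the identity or the conjugation.  Therefore
    the image of [v] has coordinates proportional to [sigma] of those of [v], which
    defines a linear or conjugate-linear isometry.  It is onto by completeness of the
    space, since its range contains [f]. *)

(** This and the next two lemmas reduce an equation that follows linearly from known ones to a ring
    identity: the multipliers [k], [l], [m] serve as a certificate for [ring] or [field]. *)
Lemma eq_lincomb1 (K : comPzRingType) (k a b x y : K) :
  a = b -> x - y = k * (a - b) -> x = y.
Proof. by move=> -> /eqP; rewrite subrr mulr0 subr_eq0 => /eqP. Qed.

Lemma eq_lincomb2 (K : comPzRingType) (k a b l c d x y : K) :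
  a = b -> c = d -> x - y = k * (a - b) + l * (c - d) -> x = y.
Proof. by move=> -> -> /eqP; rewrite !subrr !mulr0 addr0 subr_eq0 => /eqP. Qed.

Lemma eq_lincomb3 (K : comPzRingType) (k a b l c d m e f x y : K) :
  a = b -> c = d -> e = f ->
  x - y = k * (a - b) + l * (c - d) + m * (e - f) -> x = y.
Proof.
by move=> -> -> -> /eqP; rewrite !subrr !mulr0 !addr0 subr_eq0 => /eqP.
Qed.

(** The nonzero vector [(t1, t2, t3)] is in the kernel of the matrix with rows [(a2, -a1, 0)],
    [(b3, 0, -b1)], [(0, c3, -c2)], so its determinant vanishes. *)
Lemma concurrent_det (K : idomainType) (t1 t2 t3 a1 a2 b1 b3 c2 c3 : K) :
    [|| t1 != 0, t2 != 0 | t3 != 0] ->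
    t1 * a2 = t2 * a1 -> t1 * b3 = t3 * b1 -> t2 * c3 = t3 * c2 ->
  a2 * b1 * c3 = a1 * b3 * c2.
Proof.
move=> /or3P[] t0 A B D; apply: (mulfI t0).
- by apply: (eq_lincomb3 (k := b1 * c3) (l := - (a1 * c2)) (m := a1 * b1) A B D); ring.
- by apply: (eq_lincomb3 (k := b3 * c2) (l := - (a2 * c2)) (m := a2 * b1) A B D); ring.
- by apply: (eq_lincomb3 (k := b3 * c3) (l := - (a2 * c3)) (m := a1 * b3) A B D); ring.
Qed.

(** * Orthogonality preserving maps in three dimensions *)

Section Frame.
Variable C : numClosedFieldType.
Implicit Types (p q r : C -> C -> C -> C) (x y z : C).

Lemma orth2_collinear (a1 a2 t1 t2 w1 w2 : C) :
    (w1 != 0) || (w2 != 0) ->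
    a1 * w1^* + a2 * w2^* = 0 -> t1 * w1^* + t2 * w2^* = 0 ->
  t1 * a2 = t2 * a1.
Proof.
move=> /orP[] w0 A T; rewrite -conjC_eq0 in w0; apply: (mulfI w0).
- by apply: (eq_lincomb2 (k := - t2) (l := a2) A T); ring.
- by apply: (eq_lincomb2 (k := t1) (l := - a1) A T); ring.
Qed.

(** Here [p], [q], [r] are the coordinates of a representative of the image of the ray of
    [(x, y, z)]. Its scale is arbitrary and the zero vector spans no ray, hence the guards in every
    field. *)
Record orth_frame p q r : Prop := OrthFrame {
  frame_neq0 : forall x y z, [|| x != 0, y != 0 | z != 0] ->
    [|| p x y z != 0, q x y z != 0 | r x y z != 0] ;
  frame_p0 : forall y z, (y != 0) || (z != 0) -> p 0 y z = 0 ;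
  frame_q0 : forall x z, (x != 0) || (z != 0) -> q x 0 z = 0 ;
  frame_r0 : forall x y, (x != 0) || (y != 0) -> r x y 0 = 0 ;
  frame_orth : forall x y z x' y' z',
    [|| x != 0, y != 0 | z != 0] -> [|| x' != 0, y' != 0 | z' != 0] ->
    x * x'^* + y * y'^* + z * z'^* = 0 ->
    p x y z * (p x' y' z')^* + q x y z * (q x' y' z')^*
      + r x y z * (r x' y' z')^* = 0 }.

(** Permuting coordinates in source and target together carries facts about the first two
    coordinates over to every pair. *)
Lemma frame_swap12 p q r : orth_frame p q r ->
  orth_frame (fun x y z => q y x z) (fun x y z => p y x z)
             (fun x y z => r y x z).
Proof.
case=> N p0 q0 r0 O; split=> //.
- by move=> x y z n0; rewrite orbCA; apply: N; rewrite orbCA.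
- by move=> x y n0; apply: r0; rewrite orbC.
- move=> x y z x' y' z' n0 n0' o.
  rewrite [X in X + _]addrC; apply: O; rewrite 1?orbCA //.
  by rewrite [X in X + _]addrC.
Qed.

Lemma frame_swap23 p q r : orth_frame p q r ->
  orth_frame (fun x y z => p x z y) (fun x y z => r x z y)
             (fun x y z => q x z y).
Proof.
case=> N p0 q0 r0 O; split=> //.
- move=> x y z n0; rewrite [X in _ || X]orbC; apply: N.
  by rewrite [X in _ || X]orbC.
- by move=> y z n0; apply: p0; rewrite orbC.
- move=> x y z x' y' z' n0 n0' o.
  rewrite addrAC; apply: O; rewrite 1?[X in _ || X]orbC //.
  by rewrite addrAC.
Qed.

Lemma frame_neq0_12 p q r x y : orth_frame p q r -> (x != 0) || (y != 0) ->
  (p x y 0 != 0) || (q x y 0 != 0).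
Proof.
move=> F n0; have := @frame_neq0 _ _ _ F x y 0.
by rewrite (frame_r0 F n0) eqxx !orbF; apply.
Qed.

Lemma frame_orth12 p q r x y z x0 y0 : orth_frame p q r ->
    [|| x != 0, y != 0 | z != 0] -> (x0 != 0) || (y0 != 0) ->
    x * x0^* + y * y0^* = 0 ->
  p x y z * (p x0 y0 0)^* + q x y z * (q x0 y0 0)^* = 0.
Proof.
move=> F n0 m0 o; have := @frame_orth _ _ _ F x y z x0 y0 0.
rewrite eqxx orbF (frame_r0 F m0) conjC0 !mulr0 !addr0; exact.
Qed.

(** The images of [(x, y, z)] and [(x0, y0, 0)] are both orthogonal to the image of
    [(y0^*, - x0^*, 0)], which lies in the first coordinate plane. *)
Lemma frame_collinear12 p q r x y z x0 y0 : orth_frame p q r ->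
    [|| x != 0, y != 0 | z != 0] -> (x0 != 0) || (y0 != 0) -> x * y0 = y * x0 ->
  p x y z * q x0 y0 0 = q x y z * p x0 y0 0.
Proof.
move=> F n0 m0 xy.
have w0 : (y0^* != 0) || (- x0^* != 0) by rewrite oppr_eq0 !conjC_eq0 orbC.
apply: (orth2_collinear (frame_neq0_12 F w0)).
  apply: (frame_orth12 F) => //; first by rewrite orbA m0.
  by rewrite rmorphN /= !conjCK; ring.
by apply: (frame_orth12 F); rewrite // rmorphN /= !conjCK xy; ring.
Qed.

Lemma frame_collinear13 p q r x y z x0 z0 : orth_frame p q r ->
    [|| x != 0, y != 0 | z != 0] -> (x0 != 0) || (z0 != 0) -> x * z0 = z * x0 ->
  p x y z * r x0 0 z0 = r x y z * p x0 0 z0.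
Proof.
move=> F n0; apply: (frame_collinear12 (frame_swap23 F)).
by rewrite [X in _ || X]orbC.
Qed.

Lemma frame_collinear23 p q r x y z y0 z0 : orth_frame p q r ->
    [|| x != 0, y != 0 | z != 0] -> (y0 != 0) || (z0 != 0) -> y * z0 = z * y0 ->
  q x y z * r 0 y0 z0 = r x y z * q 0 y0 z0.
Proof.
move=> F n0; apply: (frame_collinear13 (frame_swap12 F)).
by rewrite orbCA.
Qed.

Lemma orth2_scaled (a1 a2 w1 w2 : C) :
    (a1 != 0) || (a2 != 0) -> (w1 != 0) || (w2 != 0) ->
    a1 * w1^* + a2 * w2^* = 0 ->
  exists2 k, k != 0 & w1 = k * a2^* /\ w2 = - (k * a1^*).
Proof.
move=> a0 w0 o.
have o1 : a1^* * w1 + a2^* * w2 = 0.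
  by apply: (can_inj conjCK); rewrite rmorphD !rmorphM /= !conjCK o conjC0.
have [a10|a10] := eqVneq a1 0.
  move: a0 o1; rewrite a10 eqxx conjC0 mul0r add0r /= => a20 /eqP.
  rewrite mulf_eq0 conjC_eq0 (negbTE a20) /= => /eqP w20.
  rewrite w20 eqxx orbF in w0; rewrite -conjC_eq0 in a20.
  by exists (w1 / a2^*); [rewrite mulf_neq0 ?invr_eq0 | rewrite mulfVK // mulr0 oppr0].
have a1c : a1^* != 0 by rewrite conjC_eq0.
have w1E : w1 = - (w2 / a1^*) * a2^*.
  by apply: (mulfI a1c); apply: (eq_lincomb1 (k := 1) o1); field.
exists (- (w2 / a1^*)); last by split=> //; rewrite mulNr opprK mulfVK.
rewrite oppr_eq0 mulf_neq0 ?invr_eq0 //.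
by apply: contraTneq w0 => w20; rewrite w1E w20 mul0r oppr0 mul0r eqxx.
Qed.

(* For each choice of signs the images of [(1, -1, 0)], [(1, 0, -1)], [(0, 1, -1)]
   (up to signs) have a common orthogonal vector, hence a vanishing determinant. *)
Lemma frame_sign_eqs p q r : orth_frame p q r ->
  let a1 := p 1 1 0 in let a2 := q 1 1 0 in
  let b1 := p 1 0 1 in let b3 := r 1 0 1 in
  let c2 := q 0 1 1 in let c3 := r 0 1 1 in
  [/\ a2 * b1 * c3 = a1 * b3 * c2,
      a1^* * b3^* * c3 = a2^* * b1^* * c2,
      a1^* * b1 * c2^* = a2^* * b3 * c3^* &
      a2 * b3^* * c2^* = a1 * b1^* * c3^*].
Proof.
move=> F a1 a2 b1 b3 c2 c3.
have o : (1 : C) != 0 := oner_neq0 C.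
have n1 : (-1 : C) != 0 by rewrite oppr_eq0.
have eN : (-1) * 1 = 1 * (-1) :> C by rewrite mulrC.
have eNN : 1 * 1 = (-1) * (-1) :> C by rewrite mulrNN.
have det x y z (x0 : x != 0) (y0 : y != 0) (z0 : z != 0) x1 y1 x2 z2 y3 z3 :
    x1 != 0 -> x2 != 0 -> y3 != 0 ->
    x * y1 = y * x1 -> x * z2 = z * x2 -> y * z3 = z * y3 ->
    q x1 y1 0 * p x2 0 z2 * r 0 y3 z3 = p x1 y1 0 * r x2 0 z2 * q 0 y3 z3.
  move=> x10 x20 y30 e1 e2 e3.
  have n0 : [|| x != 0, y != 0 | z != 0] by rewrite x0.
  apply: (concurrent_det (frame_neq0 F n0)).
  - by apply: (frame_collinear12 F) => //; rewrite x10.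
  - by apply: (frame_collinear13 F) => //; rewrite x20.
  - by apply: (frame_collinear23 F) => //; rewrite y30.
(* As [(-1, 1, 0)] is orthogonal to [(1, 1, 0)], its image is a nonzero multiple of
   [(a2^*, - a1^*, 0)]; the other two pairs are alike, and the factors [k], [l], [m] cancel from the
   determinants. *)
have [|||k k0 [a1E a2E]] := @orth2_scaled a1 a2 (p (-1) 1 0) (q (-1) 1 0).
- by apply: (frame_neq0_12 F); rewrite oner_eq0.
- by apply: (frame_neq0_12 F); rewrite n1.
- by apply: (frame_orth12 F); rewrite ?oner_eq0 ?n1 // rmorphN /= conjC1; ring.
have [|||l l0 [b1E b3E]] := @orth2_scaled b1 b3 (p (-1) 0 1) (r (-1) 0 1).
- by apply: (frame_neq0_12 (frame_swap23 F)); rewrite oner_eq0.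
- by apply: (frame_neq0_12 (frame_swap23 F)); rewrite n1.
- by apply: (frame_orth12 (frame_swap23 F)); rewrite ?oner_eq0 ?n1 //
     rmorphN /= conjC1; ring.
have [|||m m0 [c2E c3E]] := @orth2_scaled c2 c3 (q 0 (-1) 1) (r 0 (-1) 1).
- by apply: (frame_neq0_12 (frame_swap23 (frame_swap12 F))); rewrite oner_eq0.
- by apply: (frame_neq0_12 (frame_swap23 (frame_swap12 F))); rewrite n1.
- by apply: (frame_orth12 (frame_swap23 (frame_swap12 F)));
     rewrite ?oner_eq0 ?n1 // rmorphN /= conjC1; ring.
split.
- exact: (det 1 1 1).
- have := det (-1) 1 1 n1 o o (-1) 1 (-1) 1 1 1 n1 n1 o eN eN erefl.
  rewrite a1E a2E b1E b3E => E.
  apply: (mulfI (mulf_neq0 k0 l0)); apply: (eq_lincomb1 (k := -1) E).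
  by rewrite -/c2 -/c3; ring.
- have := det 1 (-1) 1 o n1 o (-1) 1 1 1 (-1) 1 n1 o n1 eNN erefl eN.
  rewrite a1E a2E c2E c3E => E.
  apply: (mulfI (mulf_neq0 k0 m0)); apply: (eq_lincomb1 (k := 1) E).
  by rewrite -/b1 -/b3; ring.
- have := det 1 1 (-1) o o n1 1 1 (-1) 1 (-1) 1 o n1 n1 erefl eNN eNN.
  rewrite b1E b3E c2E c3E => E.
  apply: (mulfI (mulf_neq0 l0 m0)); apply: (eq_lincomb1 (k := -1) E).
  by rewrite -/a1 -/a2; ring.
Qed.

(** Multiplying the first determinant equation by the conjugate of the fourth, respectively the
    third, gives equal moduli once zero coordinates are excluded. The last equation is the first
    determinant again: the same two phases also normalize the image of [(0, 1, 1)]. *)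
Lemma frame_unimodular p q r : orth_frame p q r ->
  exists l m, [/\ l * l^* = 1, m * m^* = 1 &
    [/\ q 1 1 0 = l * p 1 1 0, r 1 0 1 = m * p 1 0 1 &
        l * r 0 1 1 = m * q 0 1 1]].
Proof.
move=> F; have [] := frame_sign_eqs F.
have := frame_neq0_12 (frame_swap23 (frame_swap12 F)) (x := 1) (y := 1).
have := frame_neq0_12 (frame_swap23 F) (x := 1) (y := 1).
have := frame_neq0_12 F (x := 1) (y := 1).
rewrite oner_eq0; move=> /(_ isT) + /(_ isT) + /(_ isT).
set a1 := p 1 1 0; set a2 := q 1 1 0; set b1 := p 1 0 1; set b3 := r 1 0 1.
set c2 := q 0 1 1; set c3 := r 0 1 1 => an bn cn E1 E2 E3 E4.
have [a10 a20 [b10 b30 [c20 c30]]] : [/\ a1 != 0, a2 != 0 &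
    [/\ b1 != 0, b3 != 0 & c2 != 0 /\ c3 != 0]].
  (* In each equation both sides vanish together; as every pair has a nonzero member, a finite check
     excludes all zeros. *)
  have := congr1 (fun x => x == 0) E1; have := congr1 (fun x => x == 0) E2.
  have := congr1 (fun x => x == 0) E3; have := congr1 (fun x => x == 0) E4.
  rewrite !mulf_eq0 !conjC_eq0; move: an bn cn.
  by do 6!case: (_ == 0).
exists (a2 / a1), (b3 / b1).
have ac0 : a1^* != 0 by rewrite conjC_eq0.
have bc0 : b1^* != 0 by rewrite conjC_eq0.
have aa : a1 * a1^* = a2 * a2^*.
  apply: (mulfI (mulf_neq0 (mulf_neq0 b10 b30) (mulf_neq0 c20 c30))).
  have {}E4 : a2^* * b3 * c2 = a1^* * b1 * c3.
    by apply: (can_inj (@conjCK C)); rewrite !rmorphM /= !conjCK.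
  apply: (eq_lincomb2 (k := - (a2^* * b3 * c2)) (l := - (a1 * b3 * c2)) E1 E4).
  by ring.
have bb : b1 * b1^* = b3 * b3^*.
  apply: (mulfI (mulf_neq0 (mulf_neq0 a10 a20) (mulf_neq0 c20 c30))).
  have {}E3 : a1 * b1^* * c2 = a2 * b3^* * c3.
    by apply: (can_inj (@conjCK C)); rewrite !rmorphM /= !conjCK.
  apply: (eq_lincomb2 (k := (a1 * b1^* * c2)) (l := (a1 * b3 * c2)) E1 E3).
  by ring.
split.
- by rewrite rmorphM fmorphV; apply/eqP; rewrite mulrACA -invfM -aa divff // mulf_neq0.
- by rewrite rmorphM fmorphV; apply/eqP; rewrite mulrACA -invfM -bb divff // mulf_neq0.
split; rewrite ?mulfVK //.
by apply: (mulfI (mulf_neq0 a10 b10)); apply: (eq_lincomb1 (k := 1) E1); field;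
   rewrite a10 b10.
Qed.

End Frame.

Lemma collinear_common (K : idomainType) (a b x y x' y' : K) :
    (a != 0) || (b != 0) -> a * y = b * x -> a * y' = b * x' ->
  x * y' = y * x'.
Proof.
move=> /orP[] n0 e e'; apply: (mulfI n0).
- by apply: (eq_lincomb2 (k := - x') (l := x) e e'); ring.
- by apply: (eq_lincomb2 (k := - y') (l := y) e e'); ring.
Qed.

(** * The coordinate ratio of a normalized frame as a place of the field *)

Section NormalizedFrame.
Variable C : numClosedFieldType.
Variables p q r : C -> C -> C -> C.
Hypothesis F : orth_frame p q r.
Hypothesis E12 : q 1 1 0 = p 1 1 0.
Hypothesis E13 : r 1 0 1 = p 1 0 1.
Hypothesis E23 : r 0 1 1 = q 0 1 1.

Let o : (1 : C) != 0 := oner_neq0 C.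

Let n1 (s : C) : (1 != 0 :> C) || (s != 0). Proof. by rewrite o. Qed.
Let u1 (s t : C) : [|| 1 != 0 :> C, s != 0 | t != 0]. Proof. by rewrite o. Qed.

Lemma unit_points_neq0 : [/\ p 1 1 0 != 0, p 1 0 1 != 0 & q 0 1 1 != 0].
Proof.
split.
- by have := frame_neq0_12 F (n1 1); rewrite E12 orbb.
- by have := frame_neq0_12 (frame_swap23 F) (n1 1); rewrite /= E13 orbb.
- have := frame_neq0_12 (frame_swap23 (frame_swap12 F)) (n1 1).
  by rewrite /= E23 orbb.
Qed.

Lemma norm12 x z : (x != 0) || (z != 0) -> p x x z = q x x z.
Proof.
have [n0 _ _] := unit_points_neq0; move=> xz; apply: (mulIf n0).
rewrite -{1}E12; apply: (frame_collinear12 F); rewrite ?o //.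
by case/orP: xz => ->; rewrite ?orbT.
Qed.

Lemma norm13 x y : (x != 0) || (y != 0) -> p x y x = r x y x.
Proof.
have [_ n0 _] := unit_points_neq0; move=> xz; apply: (mulIf n0).
rewrite -{1}E13; apply: (frame_collinear13 F); rewrite ?o //.
by case/orP: xz => ->; rewrite ?orbT.
Qed.

Lemma norm23 x y : (x != 0) || (y != 0) -> q x y y = r x y y.
Proof.
have [_ _ n0] := unit_points_neq0; move=> xz; apply: (mulIf n0).
rewrite -{1}E23; apply: (frame_collinear23 F); rewrite ?o //.
by case/orP: xz => ->; rewrite ?orbT.
Qed.

(** The vector [(x, y, y)] projects onto both [(x, y, 0)] and [(x, 0, y)], and its image has equal
    second and third coordinates. *)
Lemma tau13 x y : (x != 0) || (y != 0) ->
  p x y 0 * r x 0 y = q x y 0 * p x 0 y.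
Proof.
move=> n0.
have m0 : [|| x != 0, y != 0 | y != 0] by rewrite orbb.
have pq0 : (p x y y != 0) || (q x y y != 0).
  by have := frame_neq0 F m0; rewrite -norm23 // orbb.
apply: (collinear_common pq0).
- by apply: (frame_collinear12 F) => //; apply: mulrC.
- by rewrite (norm23 n0); apply: (frame_collinear13 F) => //; apply: mulrC.
Qed.

(** The same comparison through [(x, x, y)], which projects onto [(x, 0, y)] and [(0, x, y)]. *)
Lemma tau23 x y : (x != 0) || (y != 0) ->
  p x y 0 * r 0 x y = q x y 0 * q 0 x y.
Proof.
move=> n0.
have m0 : [|| x != 0, x != 0 | y != 0] by rewrite orbA orbb.
have pq0 : (p x x y != 0) || (r x x y != 0).
  by have := frame_neq0 F m0; rewrite -norm12 // orbA orbb.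
have e : p x 0 y * q x y 0 = r x 0 y * p x y 0.
  by have := tau13 n0; rewrite mulrC => ->; rewrite mulrC.
have n13 : (p x 0 y != 0) || (r x 0 y != 0).
  by apply: (frame_neq0_12 (frame_swap23 F)).
apply: (collinear_common n13 e).
apply: (collinear_common pq0).
- by apply: (frame_collinear13 F) => //; apply: mulrC.
- by rewrite (norm12 n0); apply: (frame_collinear23 F) => //; apply: mulrC.
Qed.

Lemma frame_col12 x y z x0 y0 :
    [|| x != 0, y != 0 | z != 0] -> (x0 != 0) || (y0 != 0) -> x * y0 = y * x0 ->
  p x y z * q x0 y0 0 = q x y z * p x0 y0 0.
Proof. exact: (frame_collinear12 F). Qed.

(** By [tau13], the ratio known in the first coordinate plane also governs the plane of the first
    and third coordinates, so a single function of one variable describes the images. *)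
Lemma frame_col13 x y z x0 z0 :
    [|| x != 0, y != 0 | z != 0] -> (x0 != 0) || (z0 != 0) -> x * z0 = z * x0 ->
  p x y z * q x0 z0 0 = r x y z * p x0 z0 0.
Proof.
move=> n0 m0 e.
have k0 : (p x0 0 z0 != 0) || (r x0 0 z0 != 0).
  by apply: (frame_neq0_12 (frame_swap23 F)).
apply: (collinear_common k0).
- by have := frame_collinear13 F n0 m0 e; rewrite mulrC [RHS]mulrC => ->.
- by rewrite mulrC -(tau13 m0) mulrC.
Qed.

Lemma frame_col23 x y z y0 z0 :
    [|| x != 0, y != 0 | z != 0] -> (y0 != 0) || (z0 != 0) -> y * z0 = z * y0 ->
  q x y z * q y0 z0 0 = r x y z * p y0 z0 0.
Proof.
move=> n0 m0 e.
have k0 : (q 0 y0 z0 != 0) || (r 0 y0 z0 != 0).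
  by apply: (frame_neq0_12 (frame_swap23 (frame_swap12 F))).
apply: (collinear_common k0).
- by have := frame_collinear23 F n0 m0 e; rewrite mulrC [RHS]mulrC => ->.
- by rewrite mulrC -(tau23 m0) mulrC.
Qed.

(** [X s] and [Y s] are homogeneous coordinates of the value at [s] of the future [sigma], the value
    being infinite where [X s] vanishes. The laws of [sigma] are proved in this projective form
    until infinity is excluded. *)
Local Notation X s := (p 1 s 0).
Local Notation Y s := (q 1 s 0).

Lemma XY_neq0 s : (X s != 0) || (Y s != 0).
Proof. exact: (frame_neq0_12 F (n1 s)). Qed.

Lemma XN1 : Y (-1) = - X (-1).
Proof.
have [n0 _ _] := unit_points_neq0.
have o1 : 1 * 1^* + 1 * (-1)^* = 0 :> C by rewrite rmorphN /= conjC1; ring.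
have := frame_orth12 F (u1 1 0) (n1 (-1)) o1; rewrite E12 -mulrDr => /eqP.
rewrite mulf_eq0 (negbTE n0) -rmorphD conjC_eq0 addr_eq0 /= => /eqP ->.
by rewrite opprK.
Qed.

Lemma XN1_neq0 : X (-1) != 0.
Proof. by have := XY_neq0 (-1); rewrite XN1 oppr_eq0 orbb. Qed.

(** The triple is the image of [(1, s, s * t)], whose successive ratios are [s] and [t]. *)
Lemma XY_mult s t : exists P Q R, [/\ [|| P != 0, Q != 0 | R != 0],
  P * Y s = Q * X s, Q * Y t = R * X t & P * Y (s * t) = R * X (s * t)].
Proof.
exists (p 1 s (s * t)), (q 1 s (s * t)), (r 1 s (s * t)); split.
- exact: (frame_neq0 F).
- by apply: frame_col12 => //; ring.
- by apply: frame_col23 => //; ring.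
- by apply: frame_col13 => //; ring.
Qed.

(** In the image of [(1, s, - s)] the last two coordinates are opposite, by comparison with
    [(1, -1)]. *)
Lemma XY_opp s : X s * Y (- s) = - (Y s * X (- s)).
Proof.
have a := @frame_col12 1 s (- s) 1 s (u1 _ _) (n1 _) (mulrC _ _).
have b := @frame_col13 1 s (- s) 1 (- s) (u1 _ _) (n1 _) (mulrC _ _).
have c : q 1 s (- s) = - r 1 s (- s).
  apply: (mulIf XN1_neq0); rewrite -[LHS]opprK -mulrN -XN1 mulNr; congr (- _).
  by apply: frame_col23 => //; ring.
have PQ : (p 1 s (- s) != 0) || (q 1 s (- s) != 0).
  have := frame_neq0 F (u1 s (- s)).
  by rewrite c oppr_eq0 orbb.
rewrite -mulrN; apply: (collinear_common PQ a).
by rewrite b c; ring.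
Qed.

(** [(1, s, 0)] is orthogonal to [(s^*, -1, 0)]. The ratio of the latter's image is read off from
    the image of [(1, s^*, -1)], whose outer coordinates are opposite. *)
Lemma XY_conj s : Y s^* * (X s)^* = X s^* * (Y s)^*.
Proof.
have m0 : (s^* != 0) || (-1 != 0 :> C) by rewrite oppr_eq0 o orbT.
have w0 := frame_neq0_12 F m0.
have a : X s * (p s^* (-1) 0)^* + Y s * (q s^* (-1) 0)^* = 0.
  by apply: (frame_orth12 F) => //; rewrite rmorphN /= conjCK; ring.
have b := @frame_col12 1 (s^*) (-1) 1 (s^*) (u1 _ _) (n1 _) (mulrC _ _).
have c : q 1 (s^*) (-1) * q s^* (-1) 0 = r 1 (s^*) (-1) * p s^* (-1) 0.
  by apply: frame_col23 => //; ring.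
have d : p 1 (s^*) (-1) = - r 1 (s^*) (-1).
  apply: (mulIf XN1_neq0); rewrite -[LHS]opprK -mulrN -XN1 mulNr; congr (- _).
  by apply: frame_col13 => //; ring.
have PQ : (p 1 (s^*) (-1) != 0) || (q 1 (s^*) (-1) != 0).
  have := frame_neq0 F (u1 (s^*) (-1)).
  by rewrite d oppr_eq0 => /or3P[] ->; rewrite ?orbT.
have e : X s^* * p s^* (-1) 0 = - (Y s^* * q s^* (-1) 0).
  rewrite -mulrN; apply: (collinear_common PQ b).
  by rewrite mulrN c d mulNr.
have {}a : p s^* (-1) 0 * (X s)^* = - (q s^* (-1) 0 * (Y s)^*).
  apply: (can_inj (@conjCK C)); apply: (eq_lincomb1 (k := 1) a).
  by rewrite rmorphN !rmorphM /= !conjCK; ring.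
case/orP: w0 => w0; apply: (mulfI w0).
- by apply: (eq_lincomb2 (k := - (Y s)^*) (l := Y s^*) e a); ring.
- by apply: (eq_lincomb2 (k := (X s)^*) (l := - X s^*) e a); ring.
Qed.

(** [(1, s, - (1 + s))] is orthogonal to [(1, 1, 1)], whose image has three equal coordinates, so
    the coordinates of its own image add up to zero; [XY_opp] then removes the sign. *)
Lemma XY_succ s : X s * Y (1 + s) = (X s + Y s) * X (1 + s).
Proof.
have a := @frame_col12 1 s (- (1 + s)) 1 s (u1 _ _) (n1 _) (mulrC _ _).
have b := @frame_col13 1 s (- (1 + s)) 1 (- (1 + s)) (u1 _ _) (n1 _) (mulrC _ _).
have c : r 1 s (- (1 + s)) = - (p 1 s (- (1 + s)) + q 1 s (- (1 + s))).
  have n0 : p 1 1 1 != 0.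
    have := frame_neq0 F (u1 1 1).
    by rewrite -norm12 ?n1 // -norm13 ?n1 // !orbb.
  rewrite -conjC_eq0 in n0; apply: (mulIf n0); apply/eqP; rewrite -subr_eq0.
  have := @frame_orth _ _ _ _ F 1 s (- (1 + s)) 1 1 1 (u1 _ _) (u1 _ _).
  rewrite -(norm12 (n1 1)) -(norm13 (n1 1)) !conjC1 => <-; last by ring.
  by apply/eqP; ring.
have PQ : (p 1 s (- (1 + s)) != 0) || (q 1 s (- (1 + s)) != 0).
  have := frame_neq0 F (u1 s (- (1 + s))); apply: contraLR.
  by rewrite c !negb_or !negbK => /andP[/eqP-> /eqP->]; rewrite addr0 oppr0 eqxx.
have d := XY_opp (1 + s); have := XY_neq0 (- (1 + s)).
have e : X s * Y (- (1 + s)) = - (X s + Y s) * X (- (1 + s)).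
  move: b; rewrite c => b.
  case/orP: PQ => n0; apply: (mulfI n0).
  - by apply: (eq_lincomb2 (k := X (- (1 + s))) (l := X s) a b); ring.
  - by apply: (eq_lincomb2 (k := - X (- (1 + s)) - Y (- (1 + s))) (l := Y s) a b); ring.
move=> /orP[] n0; apply: (mulfI n0).
- by apply: (eq_lincomb2 (k := X s) (l := - X (1 + s)) d e); ring.
- by apply: (eq_lincomb2 (k := - (X s + Y s)) (l := Y (1 + s)) d e); ring.
Qed.

Lemma XY_nat n : X n%:R != 0 /\ Y n%:R = n%:R * X n%:R.
Proof.
elim: n => [|n [X0 YE]].
  have Y0 : Y 0 = 0 by apply: (frame_q0 F); rewrite o.
  by have := XY_neq0 0; rewrite Y0 eqxx orbF mul0r.
have YE' : Y n.+1%:R = n.+1%:R * X n.+1%:R.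
  rewrite -addn1 natrD addrC; apply: (mulfI X0); rewrite XY_succ YE; ring.
split=> //; have := XY_neq0 n.+1%:R.
by rewrite YE'; have [->|//] := eqVneq (X _) 0; rewrite mulr0 eqxx.
Qed.

(** For real [s] the value [sigma s] is real or infinite by [XY_conj], so its square cannot be
    [-1]. *)
Lemma X_sqr_real s : s^* = s -> X (s * s) + Y (s * s) != 0.
Proof.
move=> sr; apply/negP; rewrite addrC addr_eq0 => /eqP YN.
have [P [Q [R [n0 a b c]]]] := XY_mult s s.
have d := XY_conj s; rewrite sr in d.
have X2 : X (s * s) != 0.
  by have := XY_neq0 (s * s); rewrite YN oppr_eq0 orbb.
have RP : R = - P by apply: (mulIf X2); rewrite -c YN; ring.
have P0 : P != 0.
  apply/eqP => P0; move: n0 a b; rewrite RP P0 oppr0 eqxx orbF /= => Q0.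
  rewrite !mul0r => /esym/eqP; rewrite mulf_eq0 (negbTE Q0) /= => /eqP X0 /eqP.
  rewrite mulf_eq0 (negbTE Q0) /= => /eqP Y0.
  by have := XY_neq0 s; rewrite X0 Y0 eqxx.
have e : Y s * Y s = - (X s * X s).
  apply: (mulfI P0); move: b; rewrite RP => b.
  by apply: (eq_lincomb2 (k := Y s) (l := X s) a b); ring.
have f : (Y s * (X s)^*) * (Y s * (X s)^*)^* + (X s * (X s)^*) * (X s * (X s)^*) = 0.
  rewrite rmorphM /= conjCK.
  apply: (eq_lincomb2 (k := - (Y s * (X s)^*)) (l := (X s)^* * (X s)^*) d e).
  by ring.
have XX : 0 <= X s * (X s)^* * (X s * (X s)^*).
  by apply: mulr_ge0; rewrite mul_conjC_ge0.
have /eqP := f; rewrite paddr_eq0 ?mul_conjC_ge0 //.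
rewrite [_ && _]andbC mulf_eq0 orbb mul_conjC_eq0 => /andP[/eqP X0 _].
have := XY_neq0 s; rewrite X0 eqxx /=.
by move: e; rewrite X0 mul0r oppr0 => /eqP; rewrite mulf_eq0 orbb => ->.
Qed.

Hypothesis archi : forall t : C, t \is Num.real -> exists n : nat, t < n%:R.

(* The ratio [Y / X] behaves like a place of [C]; it takes only finite values since
   it is nonnegative or infinite at squares of reals, and the reals are archimedean. *)
Lemma X_neq0 s : X s != 0.
Proof.
apply/negP => /eqP Xs.
have Ys : Y s != 0 by have := XY_neq0 s; rewrite Xs eqxx.
have s0 : s != 0.
  by apply: contraTneq Ys => ->; rewrite (frame_q0 F) ?eqxx // o.
(* An infinite value at [s] gives one at [s^*], hence one at the positive number [t]. *)
pose t := s * s^*.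
have t0 : 0 < t by rewrite mul_conjC_gt0.
have Xsc : X s^* = 0.
  have := XY_conj s; rewrite Xs conjC0 mulr0 => /esym/eqP.
  by rewrite mulf_eq0 conjC_eq0 (negbTE Ys) orbF => /eqP.
have Ysc : Y s^* != 0 by have := XY_neq0 s^*; rewrite Xsc eqxx.
have Xt : X t = 0.
  have [P [Q [R [n0 a b c]]]] := XY_mult s s^*.
  have P0 : P = 0 by apply: (mulIf Ys); rewrite a Xs mulr0 mul0r.
  have Q0 : Q = 0 by apply: (mulIf Ysc); rewrite b Xsc mulr0 mul0r.
  move: n0 c; rewrite P0 Q0 eqxx mul0r /= => R0 /esym/eqP.
  by rewrite mulf_eq0 (negbTE R0) => /eqP.
have Yt : Y t != 0 by have := XY_neq0 t; rewrite Xt eqxx.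
have [n tn] := archi (gtr0_real t0).
(* Here [w > 1], and [w * t = n] has a finite value while that of [t] is infinite, so the value at
   [w] is zero. Then [w - 1], the square of a real number, has value [-1], against [X_sqr_real]. *)
pose w := n%:R / t.
have wt : w * t = n%:R by rewrite mulfVK // gt_eqF.
have Yw : Y w = 0.
  have [P [Q [R [n0 a b c]]]] := XY_mult w t.
  have Q0 : Q = 0 by apply: (mulIf Yt); rewrite b Xt mulr0 mul0r.
  have [Xn Yn] := XY_nat n; rewrite wt Yn in c.
  have RE : R = P * n%:R by apply: (mulIf Xn); rewrite -c mulrA.
  have P0 : P != 0.
    by apply: contraTneq n0; rewrite RE Q0 => ->; rewrite mul0r eqxx.
  by apply: (mulfI P0); rewrite a Q0 mul0r mulr0.
have Xw : X w != 0 by have := XY_neq0 w; rewrite Yw eqxx orbF.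
pose v := sqrtC (w - 1).
have w1 : 0 <= w - 1 by rewrite subr_ge0 /w ler_pdivlMr // mul1r ltW.
have v0 : 0 <= v by rewrite sqrtC_ge0.
have := X_sqr_real (geC0_conj v0); rewrite -expr2 sqrtCK.
have := XY_succ (w - 1); rewrite [1 + _]addrC subrK Yw mulr0 => /esym/eqP.
by rewrite mulf_eq0 (negbTE Xw) orbF => ->.
Qed.

Definition frame_ratio s := Y s / X s.
Local Notation sigma := frame_ratio.

Lemma ratioE a b s : a * Y s = b * X s -> b = a * sigma s.
Proof. by move=> e; rewrite mulrA e mulfK // X_neq0. Qed.

Lemma frame_ratio0 : sigma 0 = 0.
Proof. by rewrite /frame_ratio (frame_q0 F) ?mul0r // o. Qed.

Lemma frame_ratio1 : sigma 1 = 1.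
Proof. by rewrite /frame_ratio E12 divff // X_neq0. Qed.

Lemma frame_ratioM x y : sigma (x * y) = sigma x * sigma y.
Proof.
have [P [Q [R [n0 /ratioE QE /ratioE RE /ratioE RE']]]] := XY_mult x y.
have P0 : P != 0.
  by apply: contraTneq n0 => P0; rewrite RE QE P0 !mul0r eqxx.
by apply: (mulfI P0); rewrite -RE' RE QE -(mulrA P).
Qed.

Lemma frame_ratioD x y : sigma (x + y) = sigma x + sigma y.
Proof.
have S z : sigma (1 + z) = 1 + sigma z.
  apply: (mulfI (X_neq0 z)); rewrite -(ratioE (XY_succ z)).
  by rewrite mulrDr mulr1 -(@ratioE (X z) (Y z)) // mulrC.
have [->|x0] := eqVneq x 0; first by rewrite frame_ratio0 !add0r.
have -> : x + y = x * (1 + y / x) by field.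
by rewrite frame_ratioM S mulrDr mulr1 -frame_ratioM; congr (_ + sigma _); field.
Qed.

Lemma frame_ratio_conj x : sigma x^* = (sigma x)^*.
Proof.
have Xc : (X x)^* != 0 by rewrite conjC_eq0 X_neq0.
have := XY_conj x; rewrite mulrC [RHS]mulrC => /ratioE e.
by rewrite /frame_ratio rmorphM fmorphV /= -/(sigma _) e mulrAC mulfV // mul1r.
Qed.

(** Dividing by the first nonzero entry of [(x, y, z)] reduces to rays of the form [(1, s, 0)]. The
    equations say that the image is proportional to [(sigma x, sigma y, sigma z)]. *)
Lemma frame_ratioP x y z : [/\ p x y z * sigma y = q x y z * sigma x,
  p x y z * sigma z = r x y z * sigma x & q x y z * sigma z = r x y z * sigma y].
Proof.
have N a : a != 0 -> sigma a != 0.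
  move=> a0; apply: contraTneq (oner_neq0 C) => sa.
  by rewrite -frame_ratio1 -(mulfV a0) frame_ratioM sa mul0r eqxx.
have D a b : a != 0 -> sigma (b / a) = sigma b / sigma a.
  move=> a0; apply: (mulIf (N _ a0)); rewrite -frame_ratioM !mulfVK //; exact: N.
have [->|x0] := eqVneq x 0; last first.
  have n0 : [|| x != 0, y != 0 | z != 0] by rewrite x0.
  have /ratioE -> : p x y z * Y (y / x) = q x y z * X (y / x).
    by apply: frame_col12; rewrite ?n1 //; field.
  have /ratioE -> : p x y z * Y (z / x) = r x y z * X (z / x).
    by apply: frame_col13; rewrite ?n1 //; field.
  by rewrite !D //; split; field; apply: N.
have [->|y0] := eqVneq y 0; last first.
  have n0 : [|| 0 != 0 :> C, y != 0 | z != 0] by rewrite y0 orbT.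
  have /ratioE -> : q 0 y z * Y (z / y) = r 0 y z * X (z / y).
    by apply: frame_col23; rewrite ?n1 //; field.
  rewrite !D // (frame_p0 F) ?y0 // frame_ratio0; split; try ring.
  by field; apply: N.
have [->|z0] := eqVneq z 0; first by rewrite !frame_ratio0 !mulr0.
by rewrite !frame_ratio0 (frame_p0 F) ?(frame_q0 F) ?z0 ?orbT // !mul0r !mulr0.
Qed.

End NormalizedFrame.

(** * Field endomorphisms commuting with conjugation *)

Section ConjEquivariant.
Variable C : numClosedFieldType.
Hypothesis archi : forall t : C, t \is Num.real -> exists n : nat, t < n%:R.
Variable sigma : C -> C.
Hypothesis sigma1 : sigma 1 = 1.
Hypothesis sigmaD : {morph sigma : x y / x + y}.
Hypothesis sigmaM : {morph sigma : x y / x * y}.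
Hypothesis sigma_conj : forall x, sigma x^* = (sigma x)^*.

Lemma nat_floor (t : C) : 0 <= t -> exists m : nat, m%:R <= t < m.+1%:R.
Proof.
move=> t0; have [n tn] := archi (ger0_real t0).
have ex : exists n, t < n%:R by exists n.
have := ex_minnP ex; case=> -[|m] tm min_m.
  by move: (le_lt_trans t0 tm); rewrite ltxx.
exists m; rewrite tm andbT real_leNgt ?ger0_real ?ler0n //.
by apply/negP => /min_m; rewrite ltnn.
Qed.

Lemma conj_equivariant0 : sigma 0 = 0.
Proof. by apply: (addrI (sigma 0)); rewrite -sigmaD !addr0. Qed.

Lemma conj_equivariantN x : sigma (- x) = - sigma x.
Proof.
by apply: (addrI (sigma x)); rewrite -sigmaD !subrr conj_equivariant0.
Qed.

Lemma conj_equivariant_ge0 x : 0 <= x -> 0 <= sigma x.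
Proof.
move=> x0; have s0 : 0 <= sqrtC x by rewrite sqrtC_ge0.
rewrite -[x]sqrtCK expr2 -{2}(geC0_conj s0) sigmaM sigma_conj.
exact: mul_conjC_ge0.
Qed.

Lemma conj_equivariant_nat n : sigma n%:R = n%:R.
Proof.
elim: n => [|n IH]; first exact: conj_equivariant0.
by rewrite -addn1 !natrD sigmaD IH sigma1.
Qed.

(** [sigma] is monotone and fixes the naturals, so [n * x] and [n * sigma x] lie in a common
    interval [[m, m + 1]]; this bounds [n * |sigma x - x|] by one, which fails for large [n] unless
    the difference is zero. *)
Lemma conj_equivariant_nneg x : 0 <= x -> sigma x = x.
Proof.
move=> x0; apply/eqP; rewrite -subr_eq0; apply: contraT => d0.
have dr : sigma x - x \is Num.real.
  by rewrite rpredB ?ger0_real ?conj_equivariant_ge0.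
have nd0 : 0 < `|sigma x - x| by rewrite normr_gt0.
have nV0 : 0 < `|sigma x - x|^-1 by rewrite invr_gt0.
have [n nn] := archi (gtr0_real nV0).
suff : n%:R <= `|sigma x - x|^-1 by move=> /(lt_le_trans nn); rewrite ltxx.
have mono a b : a <= b -> sigma a <= sigma b.
  rewrite -subr_ge0 => /conj_equivariant_ge0.
  by rewrite sigmaD conj_equivariantN subr_ge0.
have [m /andP[ml mu]] := nat_floor (mulr_ge0 (ler0n C n) x0).
have := mono _ _ (ltW mu); have := mono _ _ ml.
rewrite sigmaM !conj_equivariant_nat => sl su.
have d1 : `|n%:R * (sigma x - x)| <= 1.
  rewrite mulrBr real_ler_norml; last first.
    by rewrite -mulrBr rpredM // realn.
  move: ml sl (ltW mu) su; rewrite -natr1 => ml sl mu' su.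
  apply/andP; split.
  - by rewrite lerBrDr addrC lerBlDr; apply: (le_trans mu'); rewrite lerD2r.
  - by rewrite lerBlDr [1 + _]addrC; apply: (le_trans su); rewrite lerD2r.
by rewrite -[_^-1]mul1r ler_pdivlMr // -[X in X * _]ger0_norm // -normrM.
Qed.

Lemma conj_equivariant_real x : x \is Num.real -> sigma x = x.
Proof.
rewrite realE => /orP[/conj_equivariant_nneg//|x0].
by rewrite -[x]opprK conj_equivariantN conj_equivariant_nneg ?oppr_ge0.
Qed.

Lemma conj_equivariant_id_or_conj : sigma =1 id \/ sigma =1 Num.conj.
Proof.
have : sigma 'i ^+ 2 == 'i ^+ 2.
  by rewrite expr2 -sigmaM -expr2 sqrCi conj_equivariantN sigma1.
rewrite eqf_sqr => /orP[] /eqP si; [left|right] => x.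
- rewrite [in LHS](Crect x) sigmaD sigmaM si.
  by rewrite !conj_equivariant_real ?Creal_Re ?Creal_Im // -Crect.
- rewrite [in LHS](Crect x) sigmaD sigmaM si.
  rewrite !conj_equivariant_real ?Creal_Re ?Creal_Im //.
  by rewrite [in RHS](Crect x) conjC_rect ?Creal_Re ?Creal_Im // mulNr.
Qed.

End ConjEquivariant.

(** Multiplying [q] and [r] by the conjugate phases normalizes the frame and keeps orthogonality, as
    the phases have modulus one. The cross-multiplied equations say that the image is proportional
    to [(sigma x, l * sigma y, m * sigma z)]. *)
Lemma frame_semilinear (C : numClosedFieldType)
    (archi : forall t : C, t \is Num.real -> exists n : nat, t < n%:R)
    (p q r : C -> C -> C -> C) : orth_frame p q r ->
  exists (sigma : C -> C) (l m : C),
    [/\ sigma =1 id \/ sigma =1 Num.conj, l * l^* = 1, m * m^* = 1 &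
    forall x y z, [/\ p x y z * (l * sigma y) = q x y z * sigma x,
      p x y z * (m * sigma z) = r x y z * sigma x &
      q x y z * (m * sigma z) = r x y z * (l * sigma y)]].
Proof.
move=> F; have [l [m [l1 m1 [E12 E13 E23]]]] := frame_unimodular F.
have lc0 : l^* != 0.
  by apply: contraTneq (oner_neq0 C) => l0; rewrite -l1 l0 mulr0 eqxx.
have mc0 : m^* != 0.
  by apply: contraTneq (oner_neq0 C) => m0; rewrite -m1 m0 mulr0 eqxx.
have F' : orth_frame p (fun x y z => l^* * q x y z) (fun x y z => m^* * r x y z).
  case: F => N p0 q0 r0 O; split=> //.
  - by move=> x y z n0; rewrite !mulf_eq0 (negbTE lc0) (negbTE mc0); apply: N.
  - by move=> x z n0; rewrite q0 // mulr0.
  - by move=> x y n0; rewrite r0 // mulr0.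
  - move=> x y z x' y' z' n0 n0' o; rewrite -[RHS](O x y z x' y' z') //.
    rewrite !rmorphM /= !conjCK; congr (_ + _ + _).
    + by rewrite -[RHS]mul1r -l1; ring.
    + by rewrite -[RHS]mul1r -m1; ring.
have E12' : l^* * q 1 1 0 = p 1 1 0 by rewrite E12 mulrA [l^* * l]mulrC l1 mul1r.
have E13' : m^* * r 1 0 1 = p 1 0 1 by rewrite E13 mulrA [m^* * m]mulrC m1 mul1r.
have E23' : m^* * r 0 1 1 = l^* * q 0 1 1.
  apply: (eq_lincomb3 (k := l^* * m^*) (l := - (m^* * r 0 1 1))
    (m := l^* * q 0 1 1) E23 l1 m1); ring.
have P := frame_ratioP F' E12' E13' E23' archi.
set sigma := frame_ratio _ _ in P.
exists sigma, l, m; split=> //.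
- apply: (conj_equivariant_id_or_conj archi).
  + exact: (frame_ratio1 F' E12' E13' E23' archi).
  + exact: (frame_ratioD F' E12' E13' E23' archi).
  + exact: (frame_ratioM F' E12' E13' E23' archi).
  + exact: (frame_ratio_conj F' E12' E13' E23' archi).
- move=> x y z; have [a b c] := P x y z; split.
  + rewrite -[RHS]mul1r -l1; apply: (eq_lincomb1 (k := l) a); ring.
  + rewrite -[RHS]mul1r -m1; apply: (eq_lincomb1 (k := m) b); ring.
  + rewrite -[LHS]mul1r -l1 -[RHS]mul1r -m1.
    by apply: (eq_lincomb1 (k := l * m) c); ring.
Qed.

(** * Coordinates in orthonormal bases *)

Section Dot.
Variables (C : numClosedFieldType) (H : lmodType C) (dot : {dot H for Num.conj}).

Lemma dotC u v : dot u v = (dot v u)^*.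
Proof. by rewrite hermC expr0 mul1r. Qed.

Lemma dotDl u v w : dot (u + v) w = dot u w + dot v w.
Proof. exact: linearDl. Qed.
Lemma dotDr u v w : dot w (u + v) = dot w u + dot w v.
Proof. exact: linearDr. Qed.
Lemma dotBl u v w : dot (u - v) w = dot u w - dot v w.
Proof. exact: linearBl. Qed.
Lemma dotNl u w : dot (- u) w = - dot u w.
Proof. exact: linearNl. Qed.
Lemma dotNr u w : dot w (- u) = - dot w u.
Proof. exact: linearNr. Qed.
Lemma dotZl a u v : dot (a *: u) v = a * dot u v.
Proof. exact: linearZl_LR. Qed.
Lemma dotZr a u v : dot u (a *: v) = a^* * dot u v.
Proof. exact: linearZr_LR. Qed.
Lemma dot0l u : dot 0 u = 0.
Proof. exact: linear0l. Qed.

Lemma dot_eq0C u v : dot u v = 0 -> dot v u = 0.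
Proof. by move=> o; rewrite dotC o conjC0. Qed.

Definition dotE := (dotDl, dotDr, dotNl, dotNr, dotZl, dotZr).

Lemma dot_residual x u : dot u u = 1 ->
  dot (x - dot x u *: u) (x - dot x u *: u) = dot x x - `|dot x u| ^+ 2.
Proof. by move=> u1; rewrite !dotE u1 (dotC u x) normCK; ring. Qed.

Lemma dot_unit_le x u : dot u u = 1 -> `|dot x u| ^+ 2 <= dot x x.
Proof. by move=> u1; rewrite -subr_ge0 -(dot_residual x u1) dnorm_ge0. Qed.

(** Completeness is expressed as maximality, so vectors are compared coordinate by coordinate and no
    infinite sums occur. *)
Definition ortho_basis (I : Type) (e : I -> H) : Prop :=
  [/\ forall i, dot (e i) (e i) = 1,
      forall i j, i <> j -> dot (e i) (e j) = 0 &
      forall x, (forall i, dot x (e i) = 0) -> x = 0].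

Lemma ortho_basis_inj (I : Type) (e : I -> H) x y : ortho_basis e ->
  (forall i, dot x (e i) = dot y (e i)) -> x = y.
Proof.
case=> _ _ c xy; apply/eqP; rewrite -subr_eq0; apply/eqP/c => i.
by rewrite dotBl xy subrr.
Qed.

Lemma ortho_basis_scale (I : Type) (e : I -> H) (l : I -> C) :
  (forall i, l i * (l i)^* = 1) -> ortho_basis e ->
  ortho_basis (fun i => l i *: e i).
Proof.
move=> l1 [n1 o c]; split=> [i|i j ij|x x0].
- by rewrite dotZl dotZr n1 mulr1 l1.
- by rewrite dotZl dotZr o // !mulr0.
- apply: c => i; have := x0 i; rewrite dotZr => /eqP; rewrite mulf_eq0.
  case/orP=> /eqP // li0; have := oner_neq0 C.
  by rewrite -(l1 i) li0 mulr0 eqxx.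
Qed.

Definition comb3 (I : Type) (e : I -> H) i j k (x y z : C) :=
  x *: e i + y *: e j + z *: e k.

Lemma dot_comb3l (I : Type) (e : I -> H) i j k x y z w :
  dot (comb3 e i j k x y z) w = x * dot (e i) w + y * dot (e j) w + z * dot (e k) w.
Proof. by rewrite !dotE. Qed.

Lemma dot_comb3r (I : Type) (e : I -> H) i j k x y z w :
  dot w (comb3 e i j k x y z)
  = x^* * dot w (e i) + y^* * dot w (e j) + z^* * dot w (e k).
Proof. by rewrite !dotE. Qed.

Section Expansion.
Variables (I : Type) (e : I -> H) (i j k : I).
Hypothesis eb : ortho_basis e.
Hypotheses (ij : i <> j) (ik : i <> k) (jk : j <> k).

Lemma dot_comb3 x y z : [/\ dot (comb3 e i j k x y z) (e i) = x,
   dot (comb3 e i j k x y z) (e j) = y & dot (comb3 e i j k x y z) (e k) = z].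
Proof.
case: eb => n1 o _; have ji := nesym ij; have ki := nesym ik; have kj := nesym jk.
by rewrite !dot_comb3l !n1 !o //; split; ring.
Qed.

Lemma dot_comb3_comb3 x y z x' y' z' :
  dot (comb3 e i j k x y z) (comb3 e i j k x' y' z')
  = x * x'^* + y * y'^* + z * z'^*.
Proof. by rewrite dot_comb3r; have [-> -> ->] := dot_comb3 x y z; ring. Qed.

Lemma comb3_neq0 x y z : [|| x != 0, y != 0 | z != 0] -> comb3 e i j k x y z != 0.
Proof.
apply: contraTneq => c0; have [] := dot_comb3 x y z.
by rewrite c0 !dot0l => <- <- <-; rewrite eqxx.
Qed.

Lemma comb3_expand w : (forall l, l <> i -> l <> j -> l <> k -> dot w (e l) = 0) ->
  w = comb3 e i j k (dot w (e i)) (dot w (e j)) (dot w (e k)).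
Proof.
move=> w0; apply: (ortho_basis_inj eb) => l.
have [a b c] := dot_comb3 (dot w (e i)) (dot w (e j)) (dot w (e k)).
have [->//|li] := pselect (l = i); have [->//|lj] := pselect (l = j).
have [->//|lk] := pselect (l = k); case: eb => _ o _.
by rewrite w0 // dot_comb3l !o ?mulr0 ?addr0 //; apply: nesym.
Qed.

End Expansion.
End Dot.

(** * Gluing the descriptions on triples of basis vectors *)

Section Glue.
Variables (C : numClosedFieldType) (H : lmodType C) (dot : {dot H for Num.conj}).
Hypothesis archi : forall t : C, t \is Num.real -> exists n : nat, t < n%:R.
Variables (I : Type) (e : I -> H) (F : H -> H).
Hypothesis eb : ortho_basis dot e.
Hypothesis fb : ortho_basis dot (F \o e).
Hypothesis F_neq0 : forall v, v != 0 -> F v != 0.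
Hypothesis F_orth : forall u v, u != 0 -> v != 0 -> dot u v = 0 ->
  dot (F u) (F v) = 0.

Local Notation c i v := (dot (F v) (F (e i))).

Lemma basis_neq0 i : e i != 0.
Proof.
apply/eqP => e0; case: eb => /(_ i) + _ _.
by rewrite e0 dot0l => /eqP; rewrite eq_sym oner_eq0.
Qed.

(** A vector orthogonal to [e l] has an image orthogonal to [F (e l)]; completeness of [F \o e]
    leaves three coordinates. *)
Lemma image_expand i j k v : i <> j -> i <> k -> j <> k -> v != 0 ->
  (forall l, l <> i -> l <> j -> l <> k -> dot v (e l) = 0) ->
  F v = comb3 (F \o e) i j k (c i v) (c j v) (c k v).
Proof.
move=> ij ik jk v0 vl; apply: (comb3_expand fb ij ik jk) => l li lj lk.
by apply: F_orth; rewrite ?basis_neq0 // vl.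
Qed.

Lemma dot_comb3_out i j k l x y z : l <> i -> l <> j -> l <> k ->
  dot (comb3 e i j k x y z) (e l) = 0.
Proof.
case: eb => _ o _ /nesym li /nesym lj /nesym lk.
by rewrite dot_comb3l !o // !mulr0 !addr0.
Qed.

Lemma image_frame i j k : i <> j -> i <> k -> j <> k ->
  orth_frame (fun x y z => c i (comb3 e i j k x y z))
    (fun x y z => c j (comb3 e i j k x y z)) (fun x y z => c k (comb3 e i j k x y z)).
Proof.
move=> ij ik jk.
have E x y z : [|| x != 0, y != 0 | z != 0] -> let v := comb3 e i j k x y z in
    F v = comb3 (F \o e) i j k (c i v) (c j v) (c k v).
  move=> n0 v; apply: image_expand => //; first exact: (comb3_neq0 eb).
  by move=> l li lj lk; apply: dot_comb3_out.
have Z l x y z : [|| x != 0, y != 0 | z != 0] ->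
    dot (comb3 e i j k x y z) (e l) = 0 -> c l (comb3 e i j k x y z) = 0.
  by move=> n0; apply: F_orth; rewrite ?basis_neq0 ?(comb3_neq0 eb).
have D := dot_comb3 eb ij ik jk.
split.
- move=> x y z n0; have := F_neq0 (comb3_neq0 eb ij ik jk n0).
  apply: contraLR; rewrite !negb_or !negbK => /and3P[/eqP a /eqP b /eqP d].
  by rewrite (E _ _ _ n0) a b d /comb3 !scale0r !addr0.
- by move=> y z n0; apply: Z; [rewrite n0 orbT | case: (D 0 y z)].
- by move=> x z n0; apply: Z; [rewrite orbCA n0 orbT | case: (D x 0 z)].
- by move=> x y n0; apply: Z; [rewrite orbA n0 | case: (D x y 0)].
- move=> x y z x' y' z' n0 n0' o.
  rewrite -(dot_comb3_comb3 fb ij ik jk) -!E //.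
  by apply: F_orth; rewrite ?(comb3_neq0 eb) // (dot_comb3_comb3 eb).
Qed.

Section Base.
Variable o : I.

(** The factor by which [F (e i)] is to be rotated relative to [F (e o)], read off from the image of
    [e o + e i]. It involves no third index, so all triples through [o] share it. *)
Definition phase i : C := if `[< i = o >] then 1 else
  c i (e o + e i) / c o (e o + e i).

Lemma phase_base : phase o = 1.
Proof. by rewrite /phase; case: asboolP. Qed.

(** The value at ['i] of the [sigma] of any triple through [o] and [i]; it tells the identity from
    the conjugation. *)
Definition phase_i i : C :=
  c i (e o + 'i *: e i) / c o (e o + 'i *: e i) / phase i.

Lemma frame_phase i j : i <> o -> j <> o -> i <> j ->
  exists sigma : C -> C, [/\ sigma =1 id \/ sigma =1 Num.conj,
    phase i * (phase i)^* = 1,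
    sigma 'i = phase_i i, sigma 'i = phase_i j &
    forall x y z, let v := comb3 e o i j x y z in
    [/\ c o v * (phase i * sigma y) = c i v * sigma x,
        c o v * (phase j * sigma z) = c j v * sigma x &
        c i v * (phase j * sigma z) = c j v * (phase i * sigma y)]].
Proof.
move=> io jo ij; have [oi oj] := (nesym io, nesym jo).
have F3 := image_frame oi oj ij.
have [sigma [l [m [sP l1 m1 P]]]] := frame_semilinear archi F3.
have s0 : sigma 0 = 0 by case: sP => ->; rewrite ?conjC0.
have s1 : sigma 1 = 1 by case: sP => ->; rewrite ?conjC1.
have sn0 x : sigma x = 0 -> x = 0.
  by case: sP => -> // /eqP; rewrite conjC_eq0 => /eqP.
have l0 : l != 0.
  by apply: contraTneq (oner_neq0 C) => l0; rewrite -l1 l0 mul0r eqxx.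
have m0 : m != 0.
  by apply: contraTneq (oner_neq0 C) => m0; rewrite -m1 m0 mul0r eqxx.
(* If the coordinate along [F (e o)] vanished, proportionality would annihilate the other two as
   well. *)
have co x y z : x != 0 -> c o (comb3 e o i j x y z) != 0.
  move=> x0; have sx : sigma x != 0 by apply: contraNneq x0 => /sn0 ->.
  have /(frame_neq0 F3) : [|| x != 0, y != 0 | z != 0] by rewrite x0.
  apply: contraTneq => p0; have [a b _] := P x y z.
  rewrite p0 !mul0r in a b; rewrite p0 eqxx /=.
  have -> : c i (comb3 e o i j x y z) = 0 by apply: (mulIf sx); rewrite -a mul0r.
  have -> : c j (comb3 e o i j x y z) = 0 by apply: (mulIf sx); rewrite -b mul0r.
  by rewrite eqxx.
have R1 y : c i (comb3 e o i j 1 y 0) / c o (comb3 e o i j 1 y 0) = l * sigma y.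
  have [a _ _] := P 1 y 0; rewrite s1 mulr1 in a.
  by rewrite -a mulrAC mulfV ?mul1r // co ?oner_neq0.
have R2 z : c j (comb3 e o i j 1 0 z) / c o (comb3 e o i j 1 0 z) = m * sigma z.
  have [_ b _] := P 1 0 z; rewrite s1 mulr1 in b.
  by rewrite -b mulrAC mulfV ?mul1r // co ?oner_neq0.
have E1 y : comb3 e o i j 1 y 0 = e o + y *: e i.
  by rewrite /comb3 scale1r scale0r addr0.
have E2 z : comb3 e o i j 1 0 z = e o + z *: e j.
  by rewrite /comb3 scale1r scale0r addr0.
have lE : phase i = l.
  by rewrite /phase asboolF // -[X in e o + X]scale1r -E1 R1 s1 mulr1.
have mE : phase j = m.
  by rewrite /phase asboolF // -[X in e o + X]scale1r -E2 R2 s1 mulr1.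
exists sigma; split=> //; first by rewrite lE.
- by rewrite /phase_i -E1 R1 lE mulrAC mulfV ?mul1r.
- by rewrite /phase_i -E2 R2 mE mulrAC mulfV ?mul1r.
- by rewrite lE mE.
Qed.

End Base.

Hypothesis three : exists i j k : I, [/\ i <> j, i <> k & j <> k].

Lemma third_index i j : exists k : I, k <> i /\ k <> j.
Proof.
have [a [b [d [ab ad bd]]]] := three.
have [ai|ai] := pselect (a = i); have [aj|aj] := pselect (a = j);
have [bi|bi] := pselect (b = i); have [bj|bj] := pselect (b = j);
  try (by exists a); try (by exists b); by exists d; split; congruence.
Qed.

Lemma id_or_conj_eq (s s' : C -> C) : s =1 id \/ s =1 Num.conj ->
  s' =1 id \/ s' =1 Num.conj -> s 'i = s' 'i -> s =1 s'.
Proof.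
have ni : 'i != - 'i :> C.
  by rewrite -addr_eq0 -mulr2n mulrn_eq0 /= neq0Ci.
case=> sE [] s'E; rewrite sE s'E ?conjCi => /eqP; rewrite ?(negbTE ni) 1?eq_sym
  ?(negbTE ni) // => _ x; by rewrite sE s'E.
Qed.

Lemma image_coordinates : exists (sigma : C -> C) (l : I -> C),
  [/\ sigma =1 id \/ sigma =1 Num.conj, forall i, l i * (l i)^* = 1 &
  forall v i j, v != 0 ->
    dot (F v) (l i *: F (e i)) * sigma (dot v (e j))
    = dot (F v) (l j *: F (e j)) * sigma (dot v (e i))].
Proof.
have [o [i0 [j0 [/nesym io /nesym jo ij0]]]] := three.
have [sigma [sP _ si0 sj0 _]] := frame_phase io jo ij0.
have l1 i : phase o i * (phase o i)^* = 1.
  have [->|ino] := pselect (i = o); first by rewrite phase_base conjC1 mulr1.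
  have [k [ki ko]] := third_index i o.
  by have [s [_ ? _ _ _]] := frame_phase ino ko (nesym ki).
(* The triple [o], [i], [i0] links [i] to the reference triple, so one [sigma] serves all triples
   through [o]. *)
have T i : i <> o -> phase_i o i = sigma 'i.
  move=> ino; have [->//|ii0] := pselect (i = i0).
  by have [s [_ _ <- -> _]] := frame_phase ino io ii0; rewrite si0.
have P i j x y z : i <> o -> j <> o -> i <> j ->
    let v := comb3 e o i j x y z in
    [/\ c o v * (phase o i * sigma y) = c i v * sigma x,
        c o v * (phase o j * sigma z) = c j v * sigma x &
        c i v * (phase o j * sigma z) = c j v * (phase o i * sigma y)].
  move=> ino jno ij; have [s [s'P _ si _ Q]] := frame_phase ino jno ij.
  have E : sigma =1 s by apply: id_or_conj_eq => //; rewrite si T.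
  by rewrite !E; apply: Q.
have P2 i j x y : i <> j -> let u := x *: e i + y *: e j in
    c i u * (phase o j * sigma y) = c j u * (phase o i * sigma x).
  move=> ij; have [io'|ino] := pselect (i = o).
    rewrite io' phase_base mul1r in ij *; have [k [kj ko]] := third_index j o.
    by have [+ _ _] := P j k x y 0 (nesym ij) ko (nesym kj);
       rewrite /comb3 scale0r addr0.
  have [jo'|jno] := pselect (j = o).
    rewrite jo' phase_base mul1r; have [k [ki ko]] := third_index i o.
    have [+ _ _] := P i k y x 0 ino ko (nesym ki).
    by rewrite /comb3 scale0r addr0 addrC => ->.
  by have [_ _] := P i j 0 x y ino jno ij; rewrite /comb3 scale0r add0r.
have sM x y : sigma (x * y) = sigma x * sigma y.
  by case: sP => E; rewrite !E ?rmorphM.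
have sN x : sigma (- x) = - sigma x by case: sP => E; rewrite !E ?rmorphN.
have sC x : sigma x^* = (sigma x)^* by case: sP => E; rewrite !E.
exists sigma, (phase o); split=> // v i j v0.
have [->//|ij] := pselect (i = j).
rewrite !dotZr; set a := dot v (e i); set b := dot v (e j).
have s0 : sigma 0 = 0 by case: sP => ->; rewrite ?conjC0.
have [/andP[/eqP-> /eqP->]|ab0] := boolP ((a == 0) && (b == 0)).
  by rewrite s0 !mulr0.
have [k [ki kj]] := third_index i j; have [ik jk] := (nesym ki, nesym kj).
(* [v] may have infinite support, so it is tested against a vector orthogonal to it and supported on
   [e i] and [e j]. The image of [u] is known up to scale by [P2], and its orthogonality to [F v]
   ties the two coordinates of [F v]. *)
pose u := comb3 e i j k b^* (- a^*) 0.
have m0 : [|| b^* != 0, - a^* != 0 | 0 != 0 :> C].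
  by rewrite oppr_eq0 !conjC_eq0 eqxx orbF orbC -negb_and.
have u0 : u != 0 by apply: (comb3_neq0 eb).
have uk : c k u = 0.
  apply: F_orth; rewrite ?basis_neq0 //.
  by have [] := dot_comb3 eb ij ik jk b^* (- a^*) 0.
have uE : u = b^* *: e i + (- a^*) *: e j by rewrite /u /comb3 scale0r addr0.
have FuE : F u = c i u *: F (e i) + c j u *: F (e j).
  rewrite [LHS](image_expand ij ik jk u0) ?uk; last first.
    by move=> l li lj lk; apply: dot_comb3_out.
  by rewrite /comb3 scale0r addr0.
have vu : dot v u = 0 by rewrite uE !dotE -/a -/b rmorphN /= !conjCK; ring.
have := F_orth v0 u0 vu; rewrite FuE !dotE => A.
have := P2 i j b^* (- a^*) ij; rewrite -uE /= sN !sC => B.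
have {}B : (c i u)^* * ((phase o j)^* * - sigma a)
            = (c j u)^* * ((phase o i)^* * sigma b).
  apply: (can_inj (@conjCK C)).
  by rewrite !(rmorphM, rmorphN) /= !conjCK.
have : (c i u != 0) || (c j u != 0).
  rewrite -negb_and; apply: contraNN (F_neq0 u0) => /andP[/eqP ui /eqP uj].
  by rewrite FuE ui uj !scale0r addr0.
case/orP; rewrite -conjC_eq0 => n0; apply: (mulfI n0).
- apply: (eq_lincomb2 (k := (phase o i)^* * sigma b) (l := c j v) A B); ring.
- apply: (eq_lincomb2 (k := - ((phase o j)^* * sigma a)) (l := - c i v) A B); ring.
Qed.

End Glue.

Section IdOrConj.
Variables (C : numClosedFieldType) (sigma : C -> C).
Hypothesis sP : sigma =1 id \/ sigma =1 Num.conj.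

Lemma id_or_conj0 : sigma 0 = 0.
Proof. by case: sP => ->; rewrite ?conjC0. Qed.
Lemma id_or_conj1 : sigma 1 = 1.
Proof. by case: sP => ->; rewrite ?conjC1. Qed.
Lemma id_or_conjD x y : sigma (x + y) = sigma x + sigma y.
Proof. by case: sP => E; rewrite !E ?rmorphD. Qed.
Lemma id_or_conjN x : sigma (- x) = - sigma x.
Proof. by case: sP => E; rewrite !E ?rmorphN. Qed.
Lemma id_or_conjM x y : sigma (x * y) = sigma x * sigma y.
Proof. by case: sP => E; rewrite !E ?rmorphM. Qed.
Lemma id_or_conjC x : sigma x^* = (sigma x)^*.
Proof. by case: sP => E; rewrite !E. Qed.
Lemma id_or_conjK : involutive sigma.
Proof. by case: sP => E x; rewrite !E // conjCK. Qed.
Lemma id_or_conj_real x : x^* = x -> sigma x = x.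
Proof. by case: sP => E; rewrite !E. Qed.
Lemma id_or_conj_eq0 x : (sigma x == 0) = (x == 0).
Proof. by case: sP => E; rewrite !E // conjC_eq0. Qed.

End IdOrConj.

(** * The semilinear isometry defined by coordinates *)

Section Operator.
Variables (C : numClosedFieldType) (H : lmodType C) (dot : {dot H for Num.conj}).
Variables (I : Type) (e g : I -> H) (F : H -> H) (sigma : C -> C).
Hypothesis eb : ortho_basis dot e.
Hypothesis gb : ortho_basis dot g.
Hypothesis F_neq0 : forall v, v != 0 -> F v != 0.
Hypothesis F_orth : forall u v, u != 0 -> v != 0 -> dot u v = 0 ->
  dot (F u) (F v) = 0.
Hypothesis sP : sigma =1 id \/ sigma =1 Num.conj.
Hypothesis F_coord : forall v i j, v != 0 ->
  dot (F v) (g i) * sigma (dot v (e j)) = dot (F v) (g j) * sigma (dot v (e i)).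

Let s0 := id_or_conj0 sP.
Let s1 := id_or_conj1 sP.
Let sD := id_or_conjD sP.
Let sN := id_or_conjN sP.
Let sM := id_or_conjM sP.
Let sC := id_or_conjC sP.

Lemma basis_coord_neq0 (f : I -> H) v : ortho_basis dot f -> v != 0 ->
  exists i, dot v (f i) != 0.
Proof.
case=> _ _ c; apply: contraNP => h; apply/eqP/c => i.
by apply/eqP; apply: contrapT => /negP n0; apply: h; exists i.
Qed.

(** [F v] already has coordinates proportional to the prescribed ones, so rescaling it replaces the
    summation of a series. *)
Lemma coordinate_image v : exists w, (forall i, dot w (g i) = sigma (dot v (e i))) /\
  (v != 0 -> exists2 a, a != 0 & w = a *: F v).
Proof.
have [->|v0] := eqVneq v 0.
  by exists 0; split=> // i; rewrite !dot0l s0.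
have [k vk] := basis_coord_neq0 eb v0.
have [m Fm] := basis_coord_neq0 gb (F_neq0 v0).
have svk : sigma (dot v (e k)) != 0 by rewrite (id_or_conj_eq0 sP).
have Fk : dot (F v) (g k) != 0.
  apply: contraNneq (mulf_neq0 Fm svk) => Fk.
  by rewrite (F_coord m k v0) Fk mul0r.
exists ((sigma (dot v (e k)) / dot (F v) (g k)) *: F v); split.
- move=> i; rewrite dotZl; apply: (mulfI Fk).
  by apply: (eq_lincomb1 (k := 1) (F_coord i k v0)); field.
- by move=> _; eexists; last reflexivity; rewrite mulf_neq0 ?invr_eq0.
Qed.

Definition coord_map v : H := projT1 (cid (coordinate_image v)).
Local Notation U := coord_map.

Lemma coord_mapE v i : dot (U v) (g i) = sigma (dot v (e i)).
Proof. by rewrite /coord_map; case: cid => w []. Qed.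

Lemma coord_map_image v : v != 0 -> exists2 a, a != 0 & U v = a *: F v.
Proof. by rewrite /coord_map; case: cid => w []. Qed.

Lemma coord_map_basis i : U (e i) = g i.
Proof.
apply: (ortho_basis_inj gb) => j; rewrite coord_mapE.
have [->|ij] := pselect (i = j).
  by case: eb gb => [-> _ _] [-> _ _].
by case: eb gb => [_ -> // _] [_ -> // _].
Qed.

Lemma coord_mapP a v w : U (a *: v + w) = sigma a *: U v + U w.
Proof.
by apply: (ortho_basis_inj gb) => j; rewrite !(coord_mapE, dotDl, dotZl) sD sM.
Qed.

Lemma coord_map0 : U 0 = 0.
Proof.
by apply: (ortho_basis_inj gb) => j; rewrite coord_mapE !dot0l s0.
Qed.

Lemma coord_mapZ a v : U (a *: v) = sigma a *: U v.
Proof. by have := coord_mapP a v 0; rewrite !addr0 coord_map0 addr0. Qed.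

Lemma coord_mapD v w : U (v + w) = U v + U w.
Proof. by have := coord_mapP 1 v w; rewrite s1 !scale1r. Qed.

Lemma coord_mapN v : U (- v) = - U v.
Proof. by rewrite -scaleN1r coord_mapZ sN s1 scaleN1r. Qed.

Lemma coord_map_orth u v : dot u v = 0 -> dot (U u) (U v) = 0.
Proof.
have [->|u0] := eqVneq u 0; first by rewrite coord_map0 !dot0l.
have [->|v0] := eqVneq v 0; first by rewrite coord_map0 => _; rewrite linear0r.
have [a _ ->] := coord_map_image u0; have [b _ ->] := coord_map_image v0.
by move=> o; rewrite dotZl dotZr F_orth // !mulr0.
Qed.

Lemma dot_conj v : (dot v v)^* = dot v v.
Proof. by rewrite -dotC. Qed.

Hypothesis I_inhabited : inhabited I.

(* If [v] is orthogonal to the unit vector [e o] and [|v| = t] then [v + t e o] and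
   [v - t e o] are orthogonal, so their images are, which gives [|U v| = t]. *)
Lemma coord_map_norm v : dot (U v) (U v) = dot v v.
Proof.
case: I_inhabited => o.
have eo : dot (e o) (e o) = 1 by case: eb.
have go : dot (g o) (g o) = 1 by case: gb.
have [a [w [vE wo]]] : exists a w, v = a *: e o + w /\ dot w (e o) = 0.
  exists (dot v (e o)), (v - dot v (e o) *: e o).
  by rewrite addrC subrK dotBl dotZl eo mulr1 subrr.
have ow := dot_eq0C wo.
have Uwo : dot (U w) (g o) = 0 by rewrite coord_mapE wo s0.
have oUw := dot_eq0C Uwo.
have Nw : dot (U w) (U w) = dot w w.
  pose t := sqrtC (dot w w).
  have t0 : 0 <= t by rewrite sqrtC_ge0 dnorm_ge0.
  have tt : t * t = dot w w by rewrite -expr2 sqrtCK.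
  have tc : t^* = t by apply: geC0_conj.
  have /coord_map_orth : dot (w + t *: e o) (w - t *: e o) = 0.
    by rewrite !dotE wo ow eo tc -tt; ring.
  rewrite !(coord_mapD, coord_mapN, coord_mapZ) coord_map_basis !dotE Uwo oUw go.
  rewrite (id_or_conj_real sP tc) tc -tt => A.
  by apply: (eq_lincomb1 (k := 1) A); ring.
have aa : sigma a * (sigma a)^* = a * a^*.
  by rewrite -sC -sM (id_or_conj_real sP) // rmorphM /= conjCK mulrC.
rewrite vE coord_mapP coord_map_basis !dotE Uwo oUw wo ow go eo Nw.
by apply: (eq_lincomb1 (k := 1) aa); ring.
Qed.

(** Subtracting from [v] its component along [w] leaves a vector orthogonal to [w]; preservation of
    orthogonality and of norms then gives the inner product, in the linear and conjugate-linear
    cases alike. *)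
Lemma coord_map_dot v w : dot (U v) (U w) = sigma (dot v w).
Proof.
have [->|w0] := eqVneq w 0; first by rewrite coord_map0 !linear0r s0.
have ww : dot w w != 0 by rewrite dnorm_eq0.
pose k := dot v w / dot w w.
have o : dot (v - k *: w) w = 0 by rewrite dotBl dotZl mulfVK // subrr.
have := coord_map_orth o.
rewrite coord_mapD coord_mapN coord_mapZ dotBl dotZl coord_map_norm => /eqP.
rewrite subr_eq0 => /eqP ->.
by rewrite -(id_or_conj_real sP (dot_conj w)) -sM mulfVK.
Qed.

End Operator.

Lemma complex_archi (R : realType) (t : R[i]) :
  t \is Num.real -> exists n : nat, t < n%:R.
Proof.
move=> /complex_realP[x ->]; exists (Num.truncn x).+1.
by rewrite -(rmorph_nat (real_complex R)) ltcR truncnS_gt.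
Qed.

(** * Hilbert space and rank one projections *)

Section Surjective.
Variables (R : realType) (H : completeNormedModType R[i]).
Variable (dot : {dot H for Num.conj}).
Hypothesis dot_norm : induces_norm dot.
Variables (I : Type) (e g : I -> H) (U : H -> H) (sigma : R[i] -> R[i]).
Hypothesis gb : ortho_basis dot g.
Hypothesis sP : sigma =1 id \/ sigma =1 Num.conj.
Hypothesis UP : forall a v w, U (a *: v + w) = sigma a *: U v + U w.
Hypothesis Udot : forall v w, dot (U v) (U w) = sigma (dot v w).
Hypothesis Ue : forall i, U (e i) = g i.

Let UD v w : U (v + w) = U v + U w.
Proof. by have := UP 1 v w; rewrite (id_or_conj1 sP) !scale1r. Qed.

Let UB v w : U (v - w) = U v - U w.
Proof.
rewrite addrC -scaleN1r UP (id_or_conjN sP) (id_or_conj1 sP) scaleN1r.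
exact: addrC.
Qed.

Let UZ a v : U (a *: v) = sigma a *: U v.
Proof.
have U0 : U 0 = 0 by have := UB 0 0; rewrite !subrr.
by have := UP a v 0; rewrite !addr0 U0 addr0.
Qed.

Local Notation D v := (dot v v).

(** [d] is the squared distance from [w] to the range of [U]. The infimum is taken in [R] and
    embedded, the squared distances being real. *)
Lemma dist_inf w : exists d : R[i], (forall v, d <= D (w - U v)) /\
  forall eps, 0 < eps -> exists v, D (w - U v) < d + eps.
Proof.
pose E := [set complex.Re (D (w - U v)) | v in [set: H]].
have DE v : (complex.Re (D (w - U v)))%:C%C = D (w - U v).
  by rewrite RRe_real // ger0_real // dnorm_ge0.
have lbE : lbound E 0.
  by move=> _ [v _ <-]; rewrite -lecR DE dnorm_ge0.
exists (inf E)%:C%C; split=> [v|eps eps0].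
  rewrite -DE lecR; apply: ge_inf; first by exists 0.
  by exists v.
have /complex_realP[x xE] : eps \is Num.real by rewrite gtr0_real.
rewrite xE ltcR in eps0 *.
have [|_ [v _ <-] vx] := @inf_adherent _ E x eps0.
  by split; [exists (complex.Re (D (w - U 0))), 0 | exists 0].
by exists v; rewrite -DE -rmorphD /= ltcR.
Qed.

(* Elements of the range of [U] nearly closest to [w] form a Cauchy sequence by the
   parallelogram law; its limit is [w] because the coordinates of the error vanish. *)
Lemma isometry_surjective w : exists v, U v = w.
Proof.
have [d [dle dex]] := dist_inf w.
have n0 n : 0 < n.+1%:R^-1 :> R[i] by rewrite invr_gt0 ltr0n.
have [v_ vP] := choice (fun n => dex _ (n0 n)).
have real_D x : (D x)^* = D x by rewrite -dotC.
have DU x : D (U x) = D x by rewrite Udot (id_or_conj_real sP).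
have half : (2^-1)^* = 2^-1 :> R[i] by rewrite fmorphV /= conjC_nat.
(* The midpoint of two range elements is again in the range, at squared distance at least [d] from
   [w], so the terms in [d] cancel in the parallelogram law. *)
have Dv_ m n : D (v_ m - v_ n) < 2 * m.+1%:R^-1 + 2 * n.+1%:R^-1.
  have := dle (2^-1 *: (v_ m + v_ n)).
  rewrite UZ (id_or_conj_real sP half) UD -(DU (v_ m - v_ n)) UB.
  set a := U (v_ m); set b := U (v_ n) => dab.
  have -> : D (a - b) = 2 * D (w - a) + 2 * D (w - b)
      - 4 * D (w - 2^-1 *: (a + b)).
    by rewrite !dotE half; field.
  have A1 k : 2 * D (w - U (v_ k)) < 2 * (d + k.+1%:R^-1).
    by rewrite ltr_pM2l ?ltr0n //; apply: vP.
  rewrite ltrBlDr; apply: (lt_le_trans (ltrD (A1 m) (A1 n))).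
  have -> : 2 * (d + m.+1%:R^-1) + 2 * (d + n.+1%:R^-1)
      = 2 * m.+1%:R^-1 + 2 * n.+1%:R^-1 + 4 * d by ring.
  by rewrite lerD2l ler_pM2l ?ltr0n.
have small eps : 0 < eps -> exists N : nat, forall n, (N <= n)%N ->
    n.+1%:R^-1 < eps :> R[i].
  move=> e0; have eV : 0 < eps^-1 by rewrite invr_gt0.
  have [N Ne] := complex_archi (gtr0_real eV); exists N => n Nn.
  rewrite invf_plt ?posrE ?ltr0n //; apply: (lt_le_trans Ne).
  by rewrite ler_nat (leq_trans Nn).
have /cauchy_cvg : cauchy (v_ @ \oo).
  apply: cauchy_exP => eps e0.
  have [N NP] := small _ (divr_gt0 (exprn_gt0 2 e0) (ltr0n _ 4 : 0 < 4)).
  exists (v_ N), N => //= n Nn; rewrite -ball_normE /=.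
  rewrite -(@ltr_pXn2r _ 2) ?nnegrE ?normr_ge0 ?(ltW e0) // dot_norm.
  apply: (lt_le_trans (Dv_ _ _)).
  have := lerD (ltW (NP N (leqnn N))) (ltW (NP n Nn)).
  rewrite -(ler_pM2l (ltr0n R[i] 2)) mulrDr => /le_trans; apply.
  by rewrite (_ : 2 * _ = eps ^+ 2) //; field.
move=> /cvg_ex[v /cvgrPdist_lt vv]; exists v.
apply: (ortho_basis_inj gb) => i; apply/eqP; rewrite -subr_eq0 -dotBl.
apply: contraT => a0; set a := dot _ _ in a0.
have a2 : 0 < `|a| / 2 by rewrite divr_gt0 ?normr_gt0.
have [N NP] := small _ (exprn_gt0 2 a2).
have [M _ MP] := vv _ a2.
pose n := maxn N M; have := MP n (leq_maxr _ _) => /= vn.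
have {}NP := NP n (leq_maxl _ _).
have g1 : dot (g i) (g i) = 1 by case: gb.
have e1 : dot (e i) (e i) = 1.
  by apply: (can_inj (id_or_conjK sP)); rewrite -Udot !Ue g1 (id_or_conj1 sP).
(* Adding [sigma b *: e i] to [v_ n] adds [b *: g i] to its image, since [sigma] is an involution,
   and lowers the squared distance by [|b|^2]. As [d] is a lower bound, [|b|^2] is below the excess
   [1 / (n + 1)]. *)
have an : `|dot (w - U (v_ n)) (g i)| < `|a| / 2.
  rewrite -(@ltr_pXn2r _ 2) ?nnegrE ?normr_ge0 ?(ltW a2) //; apply: le_lt_trans NP.
  set b := dot _ _.
  have := dle (v_ n + sigma b *: e i).
  have -> : D (w - U (v_ n + sigma b *: e i)) = D (w - U (v_ n)) - `|b| ^+ 2.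
    by rewrite UD UZ (id_or_conjK sP) Ue opprD addrA dot_residual.
  rewrite lerBrDr => /le_lt_trans /(_ (vP n)).
  by rewrite ltrD2l => /ltW.
have bn : `|dot (U (v_ n - v)) (g i)| < `|a| / 2.
  rewrite -Ue Udot; have -> : `|sigma (dot (v_ n - v) (e i))| = `|dot (v_ n - v) (e i)|.
    by case: sP => ->; rewrite ?norm_conjC.
  apply: le_lt_trans vn; rewrite -(@ler_pXn2r _ 2) ?nnegrE ?normr_ge0 //.
  rewrite distrC dot_norm.
  exact: dot_unit_le.
have : `|a| < `|a|.
  rewrite {2}[`|a|]splitr; apply: le_lt_trans (ltrD an bn).
  have -> : a = - (dot (w - U (v_ n)) (g i) + dot (U (v_ n - v)) (g i)).
    by rewrite /a UB !dotE; ring.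
  by rewrite normrN ler_normD.
by rewrite ltxx.
Qed.

End Surjective.

(** * Rank one projections and unit vectors *)

Section Projections.
Variables (R : realType) (H : normedModType R[i]) (dot : {dot H for Num.conj}).
Hypothesis dot_norm : induces_norm dot.

Definition line_proj (u x : H) : H := dot x u *: u.

Lemma norm_dot_eq (x y : H) : dot x x = dot y y -> `|x| = `|y|.
Proof.
by move=> xy; apply/eqP; rewrite -(@eqrXn2 _ 2) ?normr_ge0 // !dot_norm xy.
Qed.

Lemma line_proj_projection u : dot u u = 1 -> is_projection dot (line_proj u).
Proof.
move=> u1; split.
- split; first by move=> a x y; rewrite /line_proj !dotE scalerDl scalerA.
  exists 1 => x; rewrite rmorph1 mul1r.
  rewrite -(@ler_pXn2r _ 2) ?nnegrE ?normr_ge0 // !dot_norm.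
  rewrite /line_proj !dotE u1 mulr1 -normCK.
  exact: dot_unit_le.
- move=> x y; rewrite /line_proj !dotE (dotC dot u y).
  by rewrite mulrC.
- by apply/funext => x; rewrite /= /line_proj dotZl u1 mulr1.
Qed.

Lemma line_proj_rank_one u : dot u u = 1 -> rank_one (line_proj u).
Proof.
move=> u1; have u0 : u != 0.
  by apply: contra_eq_neq u1 => ->; rewrite dot0l eq_sym oner_neq0.
exists u => //; apply/seteqP; split=> [_ [x _ <-]|_ [a _ <-]].
- by exists (dot x u).
- by exists (a *: u) => //; rewrite /line_proj dotZl u1 mulr1.
Qed.

Lemma rank1proj_line (u : H) : dot u u = 1 ->
  exists P : rank1proj dot, P =1 line_proj u.
Proof.
by move=> u1; exists (Rank1Proj (line_proj_projection u1) (line_proj_rank_one u1)).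
Qed.

Lemma normalize (u : H) : u != 0 -> exists2 k, k != 0 & dot (k *: u) (k *: u) = 1.
Proof.
move=> u0; have n0 : sqrtC (dot u u) != 0 by rewrite sqrt_dnorm_eq0.
exists (sqrtC (dot u u))^-1; first by rewrite invr_eq0.
rewrite !dotE geC0_conj ?invr_ge0 ?sqrt_dnorm_ge0 //.
by rewrite -{3}[dot u u]sqrtCK; field.
Qed.

(** A unit vector [u] of the range is fixed by the idempotent [A], and self-adjointness gives the
    coefficient of [A x] along [u] as [dot (A x) u = dot x (A u) = dot x u]. *)
Lemma rank1proj_unit (P : rank1proj dot) :
  exists u, dot u u = 1 /\ P =1 line_proj u.
Proof.
case: P => A [bA sA idA] [u0 u0n rA] /=.
have [k k0 u1] := normalize u0n; set u := k *: u0 in u1.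
exists u; split=> // x.
have Au : A u = u.
  have [y _ yE] : range A u0 by rewrite rA; exists 1; rewrite ?scale1r.
  have Au0 : A u0 = u0 by rewrite -yE; apply: (congr1 (fun f => f y) idA).
  case: bA => lA _; have := lA k u0 0.
  have A0 : A 0 = 0 by have := lA (-1) 0 0; rewrite /= scaler0 addr0 scaleN1r addNr.
  by rewrite !addr0 A0 addr0 Au0.
have [a _ aE] : [set a *: u0 | a in [set: R[i]]] (A x) by rewrite -rA; exists x.
have Ax : A x = (a / k) *: u by rewrite /u scalerA mulfVK.
by rewrite /line_proj -[in RHS]Au -sA Ax dotZl u1 mulr1 Au.
Qed.

Lemma line_proj_orth u v : dot u u = 1 -> dot v v = 1 ->
  (forall x, line_proj u (line_proj v x) = 0) <-> dot v u = 0.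
Proof.
move=> u1 v1; split=> [/(_ v)|vu x].
- rewrite /line_proj v1 scale1r => /(congr1 (fun w => dot w u)).
  by rewrite dotZl u1 mulr1 dot0l.
- by rewrite /line_proj dotZl vu mulr0 scale0r.
Qed.

Definition r1p_vec (P : rank1proj dot) : H := projT1 (cid (rank1proj_unit P)).

Lemma r1p_vec_unit P : dot (r1p_vec P) (r1p_vec P) = 1.
Proof. by rewrite /r1p_vec; case: cid => u []. Qed.

Lemma r1p_vec_neq0 P : r1p_vec P != 0.
Proof.
by apply: contra_eq_neq (r1p_vec_unit P) => ->; rewrite dot0l eq_sym oner_neq0.
Qed.

Lemma r1p_vecE (P : rank1proj dot) : P =1 line_proj (r1p_vec P).
Proof. by rewrite /r1p_vec; case: cid => u []. Qed.

Lemma proj_orthE P Q : proj_orth P Q <-> dot (r1p_vec P) (r1p_vec Q) = 0.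
Proof.
have E := line_proj_orth (r1p_vec_unit P) (r1p_vec_unit Q); split=> [o|o x].
  by apply: dot_eq0C; apply: (proj1 E) => x; rewrite -!r1p_vecE.
by rewrite !r1p_vecE; apply: (proj2 E); apply: dot_eq0C.
Qed.

Lemma rank1proj_of_vector v : v != 0 ->
  exists P : rank1proj dot, exists2 k, k != 0 & r1p_vec P = k *: v.
Proof.
move=> v0; have [k k0 u1] := normalize v0.
have [P PE] := rank1proj_line u1; exists P.
have := PE (k *: v); rewrite [RHS]/line_proj u1 scale1r r1p_vecE /line_proj.
set a := dot _ _ => kv.
have a0 : a != 0.
  by apply: contra_eq_neq kv => ->; rewrite scale0r eq_sym scaler_eq0 negb_or k0.
exists (a^-1 * k); first by rewrite mulf_neq0 ?invr_eq0.
by rewrite -scalerA -kv scalerA mulVf // scale1r.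
Qed.

(** A nonzero vector orthogonal to the whole system would span a projection contradicting
    maximality. *)
Lemma cosp_basis (T : Type) (P : T -> rank1proj dot) : COSP (range P) ->
  injective P -> ortho_basis dot (r1p_vec \o P).
Proof.
move=> [_ o c] injP; split=> [i|i j ij|x xP] /=.
- exact: r1p_vec_unit.
- apply/proj_orthE; apply: o; [by exists i|by exists j|by move=> /injP].
- apply: contrapT => /eqP x0; apply: c.
  have [Q [k _ QE]] := rank1proj_of_vector x0; exists Q => _ [i _ <-].
  by apply/proj_orthE; rewrite QE dotZl xP mulr0.
Qed.

End Projections.

(** With at most two basis vectors, the 3 by 2 matrix of inner products with three independent
    vectors has a nonzero left kernel; this yields a nontrivial combination orthogonal to the basis,
    hence zero. *)
Lemma ortho_basis_three (C : numClosedFieldType) (H : lmodType C)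
    (dot : {dot H for Num.conj}) (I : Type) (e : I -> H) :
  ortho_basis dot e -> dim_ge H 3 -> exists i j k : I, [/\ i <> j, i <> k & j <> k].
Proof.
move=> [_ _ c] [b bfree]; apply: contrapT => no3.
(* A smaller basis is padded to two vectors by repetition, or by zeros if it is empty. *)
have [f fc] : exists f : 'I_2 -> H, forall x, (forall k, dot x (f k) = 0) -> x = 0.
  have [[i [j ij]]|no2] := pselect (exists i j : I, i <> j).
    exists (fun k => if k == 0 then e i else e j) => x xf; apply: c => k.
    have := xf 0; have := xf 1; rewrite /= => xj xi.
    have [<-//|ki] := pselect (i = k); have [<-//|kj] := pselect (j = k).
    by exfalso; apply: no3; exists i, j, k.
  have [[i _]|no1] := pselect (exists i : I, True).
    exists (fun=> e i) => x xf; apply: c => k.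
    have [<-|ik] := pselect (i = k); first exact: xf 0.
    by exfalso; apply: no2; exists i, k.
  by exists (fun=> 0) => x _; apply: c => k; exfalso; apply: no1; exists k.
pose M := \matrix_(r < 3, k < 2) dot (b r) (f k).
have : kermx M != 0.
  rewrite kermx_eq0 /row_free neq_ltn.
  by rewrite (leq_ltn_trans (rank_leq_col M)).
case/matrix0Pn => s [r sr].
have := bfree (fun r => kermx M s r) _ r; move=> bs.
apply/negP: sr; rewrite negbK; apply/eqP; apply: bs; apply: fc => k.
have := congr1 (fun A : 'M_(3, 2) => A s k) (mulmx_ker M).
rewrite [LHS]mxE [RHS]mxE => <-; rewrite linear_sumlz.
apply: eq_bigr => t _; apply: etrans (dotZl dot _ _ _) _; by rewrite [M t k]mxE.
Qed.

(** * From projections to vectors and back *)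

Theorem theorem1p1 (R : realType) (H : completeNormedModType R[i])
    (dot : {dot H for Num.conj})
    (dot_norm : induces_norm dot)
    (H_separable : separable_space H)
    (H_dim : dim_ge H 3)
    (phi : rank1proj dot -> rank1proj dot)
    (phi_orth : preserves_orth phi)
    (phi_cosp : exists S : set (rank1proj dot), COSP S /\ COSP (phi @` S)) :
  wigner_symmetry phi.
Proof.
have [S [Scosp phiScosp]] := phi_cosp.
pose I := {P : rank1proj dot | S P}.
pose e (i : I) := r1p_vec (sval i).
have sval_range : range (sval : I -> rank1proj dot) = S.
  apply/seteqP; split=> [_ [[P SP] _ <-]//|P SP].
  by exists (exist _ P SP).
have eb : ortho_basis dot e.
  apply: cosp_basis => //; first by rewrite sval_range.
  by move=> [P SP] [Q SQ] /= PQ; apply: eq_exist.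
(* [F v] is a unit vector in the range of the image of the projection onto the line of [v]; its
   value at zero is left unspecified. *)
have /choice[F FP] : forall v : H, exists w, v != 0 -> exists P : rank1proj dot,
    (exists2 k, k != 0 & r1p_vec P = k *: v) /\ w = r1p_vec (phi P).
  move=> v; have [->|v0] := eqVneq v 0; first by exists 0.
  have [P Pv] := rank1proj_of_vector dot_norm v0.
  by exists (r1p_vec (phi P)) => _; exists P.
have F_neq0 v : v != 0 -> F v != 0.
  by move=> /FP[P [_ ->]]; apply: r1p_vec_neq0.
have F_orth u v : u != 0 -> v != 0 -> dot u v = 0 -> dot (F u) (F v) = 0.
  move=> /FP[P [[k _ PE] ->]] /FP[Q [[l _ QE] ->]] uv.
  by apply/proj_orthE/phi_orth/proj_orthE; rewrite PE QE !dotE uv !mulr0.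
(* The projection found from [r1p_vec P] has a unit vector differing from it by a scalar of modulus
   one, so it is [P] itself. *)
have F_vec P : F (r1p_vec P) = r1p_vec (phi P).
  have [Q [[k k0 QE] ->]] := FP _ (r1p_vec_neq0 P); congr (r1p_vec (phi _)).
  apply: rank1proj_ext; apply/funext => x; rewrite !r1p_vecE /line_proj QE.
  have kk : k * k^* = 1.
    by have := r1p_vec_unit Q; rewrite QE !dotE r1p_vec_unit mulr1.
  rewrite dotZr scalerA; congr (_ *: _).
  by apply: (eq_lincomb1 (k := dot x (r1p_vec P)) kk); ring.
have fb : ortho_basis dot (F \o e).
  have -> : F \o e = @r1p_vec R H dot \o (phi \o sval).
    by apply/funext => i; rewrite /= F_vec.
  apply: cosp_basis => //.
    have -> // : range (phi \o (sval : I -> _)) = phi @` S.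
    by rewrite -(image_comp (sval : I -> _) phi) sval_range.
  (* [phi] is injective on [S]: distinct members are orthogonal, so a common image would be
     orthogonal to itself. *)
  move=> [P SP] [Q SQ] /= PQ; apply: eq_exist; apply: contrapT => nPQ.
  case: Scosp => _ So _; have /proj_orthE := phi_orth _ _ (So _ _ SP SQ nPQ).
  by rewrite PQ r1p_vec_unit => /eqP; rewrite oner_eq0.
have three := ortho_basis_three eb H_dim.
have [sigma [l [sP l1 Fcoord]]] :=
  image_coordinates (@complex_archi R) eb fb F_neq0 F_orth three.
pose g i := l i *: (F \o e) i.
have gb : ortho_basis dot g := ortho_basis_scale l1 fb.
have Iinh : inhabited I by case: three => i _; exact: inhabits i.
pose U := coord_map eb gb F_neq0 sP Fcoord.
have UP a v w : U (a *: v + w) = sigma a *: U v + U w by apply: coord_mapP.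
have Udot v w : dot (U v) (U w) = sigma (dot v w) by apply: coord_map_dot.
have Ue i : U (e i) = g i by apply: coord_map_basis.
have [V VP] := choice (isometry_surjective dot_norm gb sP UP Udot Ue).
have Uinj : injective U.
  move=> v w UE; apply: (ortho_basis_inj eb) => i.
  by apply: (can_inj (id_or_conjK sP)); rewrite -!Udot UE.
have UK : cancel U V by move=> v; apply: Uinj; rewrite VP.
have U_norm v : `|U v| = `|v|.
  apply: (norm_dot_eq dot_norm); rewrite Udot (id_or_conj_real sP) //.
  by rewrite -dotC.
have UZ a v : U (a *: v) = sigma a *: U v.
  have U0 : U 0 = 0 by apply/eqP; rewrite -normr_eq0 U_norm normr0.
  by have := UP a v 0; rewrite !addr0 U0 addr0.
exists U, V; split.
- have [sE|sE] := sP; [left|right].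
  + split=> //.
    * split; first by move=> a v w; rewrite UP sE.
      by exists 1 => v; rewrite rmorph1 mul1r U_norm.
    * by move=> x y; rewrite -{1}[y]VP Udot sE.
  + split=> //; first by move=> a v w; rewrite UP sE.
    move=> x y; rewrite -[RHS]U_norm; congr `|_|.
    by rewrite [in RHS]addrC -[in RHS]scaleN1r UP sE rmorphN rmorph1 scaleN1r addrC.
(* [U] maps the unit vector of [P] to a multiple of that of [phi P]; the factor [a] has modulus one
   and drops out of the projection. *)
- move=> P; apply/funext => x /=; rewrite !r1p_vecE /line_proj UZ -Udot VP -F_vec.
  have [a _ UE] : exists2 a, a != 0 & U (r1p_vec P) = a *: F (r1p_vec P).
    exact: (coord_map_image eb gb F_neq0 sP Fcoord (r1p_vec_neq0 P)).
  have aa : a * a^* = 1.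
    have := Udot (r1p_vec P) (r1p_vec P).
    rewrite r1p_vec_unit (id_or_conj1 sP) UE !dotE.
    by rewrite F_vec r1p_vec_unit mulr1.
  rewrite UE dotZr scalerA; congr (_ *: _).
  by apply: (eq_lincomb1 (k := - dot x (F (r1p_vec P))) aa); ring.
Qed.
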